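(* Let $G$ be any group with any (possibly infinite) collection $\{\sigma_j\mid j\in J\}$ of pairwise non-isomorphic splittings. Suppose $\{\sigma_j\mid j\in J\}$ satisfies sandwiching, and that $T_1$ and $T_2$ are algebraic regular neighborhoods of $\{\sigma_j\mid j\in J\}$. Then there exists a $G$-equivariant, color preserving isomorphism from $T_1$ to $T_2$.
   Context: For $X\subset G$, $X^*=G\setminus X$, $\Sigma(X)=\{gX,gX^*\mid g\in G\}$, $\mathrm{Stab}(X)=\{g: gX=X\}$. A subset of $G$ is $H$-finite if it is contained in finitely many right cosets $Hg_i$. The corners of a pair $(A,B)$ are $A\cap B$, $A\cap B^*$, $A^*\cap B$, $A^*\cap B^*$. A $G$-tree is a simplicial tree with a simplicial $G$-action that inverts no edge; it is minimal if it has no proper $G$-invariant subtree. A splitting of $G$ is a $G$-tree $T$ with no global fixed point such that $G\backslash T$ has exactly one edge; it is over $H$ if $H$ is an edge stabilizer. Two splittings are isomorphic if their trees are $G$-equivariantly isomorphic. An $H$-almost invariant set arising from the splitting is a set $X=\{g\in G : e \text{ points away from } gv\}$, where $v$ is a vertex of $T$, $e$ is a directed edge of $T$, and $H=\mathrm{Stab}(e)=\mathrm{Stab}(X)$; ''$e$ points away from $gv$'' means that $gv$ lies in the component of $T$ minus the interior of $e$ containing the initial vertex of $e$. For translates $A,B$ of sets arising from splittings or of their complements, a corner of $(A,B)$ is small if it is $\mathrm{Stab}(A)$-finite (equivalently, $\mathrm{Stab}(B)$-finite); $A$ crosses $B$ if no corner is small; $A\leq B$ means that $A\cap B^*$ is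 empty or is the only small corner of $(A,B)$. If $X$, $Y$ arise from splittings $\sigma,\tau$ over $H,K$, then $i(\sigma,\tau)$ is the number of double cosets $KgH$ such that $gX$ crosses $Y$; and $\sigma$ is sandwiched by $\tau$ if either there exist $A,B\in\Sigma(Y)$ with $A\leq X\leq B$, or $X$ crosses every element of $\Sigma(Y)$ (independent of the choice of $X,Y$). A collection $\{\sigma_j\}$ satisfies sandwiching if $\sigma_j$ is sandwiched by $\sigma_k$ for all $j,k$. Enclosing: for a $G$-tree $T$, a vertex $V$ of $T$ and a splitting $\sigma$, the orbit of $V$ encloses $\sigma$ if $T$ can be refined by inserting an edge at each vertex in the orbit of $V$ so that the new edges form a tree for $\sigma$; precisely, there is a $G$-tree $T'$ and a $G$-orbit of edges of $T'$ (''$\sigma$ edges'') such that $T'$ with all non-$\sigma$ edges collapsed is $G$-equivariantly isomorphic to the tree for $\sigma$, and $T'$ with all $\sigma$ edges collapsed is $G$-equivariantly isomorphic to $T$ (with the $\sigma$ edges collapsing to vertices in the orbit of $V$). In a collection, $\sigma_j$ is isolated if $i(\sigma_j,\sigma_k)=0$ for every other $k$. A vertex of a $G$-tree is isolated if it has valence two both in the tree and in its quotient by $G$. An algebraic regular neighborhood of a collection $\{\sigma_j\mid j\in J\}$ of pairwise non-isomorphic splittings satisfying sandwiching is a bipartite $G$-tree $T$ (vertex colors $V_0$, $V_1$, preserved by $G$) such that: (1) each $\sigma_j$ is enclosed by some $V_0$-vertex orbit, and each $V_0$-vertex orbit encloses some $\sigma_j$; (2) if $\sigma$ is a splitting of $G$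 such that for all $j\in J$, $\sigma$ is sandwiched by $\sigma_j$ and $i(\sigma,\sigma_j)=0$, then $\sigma$ is enclosed by some $V_1$-vertex orbit; (3) $T$ is a minimal $G$-tree; (4) there is a bijection $f$ from $\{j\in J\mid\sigma_j\text{ is isolated}\}$ to the set of $G$-orbits of isolated $V_0$-vertices of $T$ such that $f(j)$ encloses $\sigma_j$; (5) every non-isolated $V_0$-vertex orbit encloses some non-isolated $\sigma_j$. *)

(* Defs.v *)
From HB Require Import structures.
From mathcomp Require Import all_boot.
From mathcomp Require Import boolp classical_sets functions cardinality.

Set Implicit Arguments.
Unset Strict Implicit.
Unset Printing Implicit Defensive.

Local Open Scope group_scope.
Local Open Scope classical_set_scope.
Local Open Scope card_scope.
Local Open Scope quotient_scope.

Section Subsets.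
Context {G : groupType}.
Implicit Types (X Y A B C H K : set G).

Definition translate (g : G) X : set G := [set g * x | x in X].

Definition Sigma X : set (set G) :=
  [set A | exists g, A = translate g X \/ A = translate g (~` X)].

Definition Stab X : set G := [set g | translate g X = X].

(* fin_mod H A: A is H-finite *)
Definition fin_mod H A : Prop :=
  exists2 F : set G, finite_set F & A `<=` [set h * g | h in H & g in F].

(* The corners of (A, B): corner true true is A `&` B, corner true false is
   A `&` ~` B, corner false true is ~` A `&` B, and so on. *)
Definition side (b : bool) A : set G := if b then A else ~` A.
Definition corner (b c : bool) A B : set G := side b A `&` side c B.

Definition small_corner (b c : bool) A B : Prop :=
  fin_mod (Stab A) (corner b c A B).

Definition crosses A B : Prop := forall b c, ~ small_corner b c A B.

(* A <= B *)
Definition ai_le A B : Prop :=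
  corner true false A B = set0 \/
  (forall b c, small_corner b c A B <-> b = true /\ c = false).

Definition double_coset K (g : G) H : set G :=
  [set k * g * h | k in K & h in H].

(* The double cosets K g H with g X crossing Y, for H = Stab X, K = Stab Y *)
Definition crossing_double_cosets X Y : set (set G) :=
  [set double_coset (Stab Y) g (Stab X) | g in
    [set g | crosses (translate g X) Y]].

End Subsets.

(* The vertices form a choiceType, and adjacency is boolean, so that the
   library's paths and quotients apply; by boolp every type is a choiceType
   ({classic T}) and every Prop is reflected by a bool, so this is no
   restriction. *)
Record ggraph (G : groupType) := GGraph {
  vertex :> choiceType;
  adj : rel vertex;
  act : G -> vertex -> vertex
}.

Definition joined (V : Type) (r : rel V) (x y : V) : Prop :=
  exists2 p, path r x p & last x p = y.

(* Simplicial graphs are simple, hence determined by adjacency; for such a graph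
   [:: x; y] with x, y adjacent counts as a cycle for ucycleb, and circuits are
   the longer ones. *)
Record is_gtree (G : groupType) (T : ggraph G) : Prop := {
  act1g : forall x : T, act 1 x = x;
  actMg : forall (g h : G) (x : T), act (g * h) x = act g (act h x);
  act_adj : forall (g : G) (x y : T), adj (act g x) (act g y) = adj x y;
  adj_sym : forall x y : T, adj x y = adj y x;
  adj_irr : forall x : T, ~~ adj x x;
  tree_inhabited : exists x : T, True;
  tree_connected : forall x y : T, joined (@adj G T) x y;
  tree_acyclic : forall c : seq T, ucycleb (@adj G T) c -> (size c <= 2)%N;
  act_noinv : forall (g : G) (x y : T),
    adj x y -> ~ (act g x = y /\ act g y = x)
}.

Record gtree (G : groupType) := GTree {
  gtree_graph :> ggraph G;
  gtreeP : is_gtree gtree_graph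
}.

Definition giso (G : groupType) (S T : ggraph G) (f : S -> T) : Prop :=
  [/\ bijective f,
      forall (g : G) x, f (act g x) = act g (f x) &
      forall x y, adj (f x) (f y) = adj x y].

Definition gisomorphic (G : groupType) (S T : ggraph G) : Prop :=
  exists f : S -> T, giso f.

Section Orbits.
Context {G : groupType} {T : ggraph G}.

Definition orbit (x : T) : set T := [set act g x | g in [set: G]].

Definition dedge_orbit (e : T * T) : set (T * T) :=
  [set (act g e.1, act g e.2) | g in [set: G]].

(* The G-orbit of the unoriented edge {a, b} *)
Definition edge_orbit (a b : T) : rel T :=
  [rel x y | `[< dedge_orbit (a, b) (x, y) \/ dedge_orbit (a, b) (y, x) >]].

(* A subtree, given by its vertices: in a tree a connected subgraph contains
   every edge between two of its vertices. *)
Definition is_subtree (S : set T) : Prop :=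
  S !=set0 /\
  {in S &, forall x y, joined [rel u v | [&& u \in S, v \in S & adj u v]] x y}.

Definition minimal_gtree : Prop :=
  forall S : set T, is_subtree S ->
    (forall (g : G) x, S x -> S (act g x)) -> S = setT.

(* The oriented edges starting at v, in T and in the quotient of T by G; a loop
   of the quotient yields two oriented edges. *)
Definition star (v : T) : set (T * T) := [set e | e.1 = v /\ adj e.1 e.2].
Definition quotient_star (v : T) : set (set (T * T)) :=
  [set dedge_orbit e | e in [set e | orbit v e.1 /\ adj e.1 e.2]].

Definition isolated_vertex (v : T) : Prop :=
  star v #= `I_2 /\ quotient_star v #= `I_2.

End Orbits.

Arguments minimal_gtree {G} T.

Section Collapse.
Context {G : groupType} (T : ggraph G) (E : rel T).

Definition symE : rel T := [rel x y | E x y || E y x].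
Definition collapse_rel : rel T := [rel x y | `[< joined symE x y >]].

Lemma collapse_refl : reflexive collapse_rel.
Proof. by move=> x; apply/asboolP; exists [::]. Qed.

Lemma collapse_sym : symmetric collapse_rel.
Proof.
suff h x y : collapse_rel x y -> collapse_rel y x.
  by move=> x y; apply/idP/idP; apply: h.
move=> /asboolP[p hp <-]; apply/asboolP.
exists (rev (belast x p)).
  rewrite rev_path; apply: sub_path hp => u v /=.
  by rewrite /symE /= orbC.
by case: p hp => //= z p _; rewrite rev_cons last_rcons.
Qed.

Lemma collapse_trans : transitive collapse_rel.
Proof.
move=> y x z /asboolP[p hp py] /asboolP[q hq qz]; apply/asboolP.
by exists (p ++ q); rewrite ?cat_path ?last_cat py // hp.
Qed.

Definition collapse_equiv : equiv_rel T :=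
  EquivRel collapse_rel collapse_refl collapse_sym collapse_trans.

Definition collapse_vertex : choiceType := {eq_quot collapse_equiv}.

Definition to_collapse (x : T) : collapse_vertex :=
  \pi_({eq_quot collapse_equiv}) x.

(* The graph obtained by collapsing each component of the subgraph E to a vertex
   (the action is independent of the representative when E is G-invariant) *)
Definition collapse : ggraph G := {|
  vertex := collapse_vertex;
  adj := [rel a b | `[< exists x y,
    [/\ to_collapse x = a, to_collapse y = b, adj x y & ~~ symE x y] >]];
  act := fun g a => to_collapse (act g (repr a))
|}.

End Collapse.

Record splitting (G : groupType) := Splitting {
  splitting_tree :> gtree G;
  (* no edge is inverted, so a global fixed point would be a fixed vertex *)
  splitting_nofix : forall x : splitting_tree, exists g : G, act g x <> x;
  splitting_one_edge : exists a b : splitting_tree,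
    adj a b /\ forall x y : splitting_tree, adj x y -> edge_orbit a b x y
}.

Section HalfTree.
Context {G : groupType} {T : ggraph G}.

Definition remove_edge (e : T * T) : rel T :=
  [rel x y | [&& adj x y, (x, y) != e & (y, x) != e]].

(* The oriented edge e goes from e.1 to e.2. *)
Definition points_away (e : T * T) (w : T) : Prop :=
  joined (remove_edge e) e.1 w.

Definition Stab_edge (e : T * T) : set G :=
  [set g | act g e.1 = e.1 /\ act g e.2 = e.2].

End HalfTree.

Section Pairs.
Context {G : groupType}.
Implicit Types (s t : splitting G).

Definition arises_from s (X : set G) : Prop :=
  exists (v : s) (e : s * s),
    [/\ adj e.1 e.2,
        X = [set g | points_away e (act g v)] &
        Stab_edge e = Stab X].

(* intersection_number s t n is i(s, t) = n. This and sandwiching do not depend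
   on the choice of X and Y, which always exist. *)
Definition intersection_number s t (n : nat) : Prop :=
  exists X Y, [/\ arises_from s X, arises_from t Y &
                  crossing_double_cosets X Y #= `I_n].

Definition sandwiched s t : Prop :=
  exists X Y, [/\ arises_from s X, arises_from t Y &
    (exists A B, [/\ Sigma Y A, Sigma Y B, ai_le A X & ai_le X B]) \/
    (forall B, Sigma Y B -> crosses X B)].

(* The orbit of v encloses s; the edges of s are those in the orbit of {a, b} *)
Definition encloses (T : gtree G) (v : T) s : Prop :=
  exists (T' : gtree G) (a b : T'),
    [/\ adj a b,
        gisomorphic (collapse [rel x y | adj x y && ~~ edge_orbit a b x y]) s &
        exists2 f : collapse (edge_orbit a b) -> T,
          giso f &
          forall x y, edge_orbit a b x y -> orbit v (f (to_collapse _ x))].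

End Pairs.

Section Collections.
Context {G : groupType} {J : Type} (sigma : J -> splitting G).

Definition pairwise_nonisomorphic : Prop :=
  forall j k, j <> k -> ~ gisomorphic (sigma j) (sigma k).

Definition satisfies_sandwiching : Prop :=
  forall j k, sandwiched (sigma j) (sigma k).

Definition isolated (j : J) : Prop :=
  forall k, k <> j -> intersection_number (sigma j) (sigma k) 0.

(* The vertices of color V_0 are those satisfying V0, the others have color
   V_1. *)
Record alg_reg_nbhd (T : gtree G) (V0 : pred T) : Prop := {
  arn_bipartite : forall x y : T, adj x y -> V0 x != V0 y;
  arn_color_act : forall (g : G) (x : T), V0 (act g x) = V0 x;
  arn_enclosed : forall j, exists2 v, V0 v & encloses v (sigma j);
  arn_V0_encloses : forall v, V0 v -> exists j, encloses v (sigma j);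
  arn_V1_encloses : forall s : splitting G,
    (forall j, sandwiched s (sigma j) /\ intersection_number s (sigma j) 0) ->
    exists2 v, ~~ V0 v & encloses v s;
  arn_minimal : minimal_gtree T;
  arn_isolated : exists f : J -> set T,
    set_bij [set j | isolated j]
            [set orbit v | v in [set v | V0 v /\ isolated_vertex v]] f /\
    (forall j, isolated j -> forall v, f j v -> encloses v (sigma j));
  arn_nonisolated : forall v, V0 v -> ~ isolated_vertex v ->
    exists2 j, ~ isolated j & encloses v (sigma j)
}.

End Collections.

(* Main.v *)
Require Import Defs.
From mathcomp Require Import all_boot.
From mathcomp Require Import boolp classical_sets functions cardinality.

(** An edge of a minimal tree gives an almost invariant subset of [G], well
    defined up to almost equality. If a tree encloses a splitting at [v], then
    the set of an edge of the splitting lies "at" [v]: each edge of the tree has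
    the side not containing [v] almost inside this set or its complement. A set
    lies at two distinct vertices only if it is almost equal to the set of every
    edge between them, which for an edge of [sigma j] forces [sigma j] to be
    isolated. Each edge of the first tree is itself a splitting satisfying (2),
    so it is enclosed at a [V_1]-vertex of the second one, and conversely.
    Playing the two against each other matches the [V_0]-vertices through the
    edges of the [sigma j] lying at them, and then the edges with equivalent
    sets. Equivalent edges of one tree are separated by vertices of valence two
    only; there the order is recovered because the isolated [V_0]-vertices
    matched with one [sigma j] inherit the order of its edges, while two
    neighbouring isolated ones with equivalent edges come from isomorphic
    splittings, hence from the same [j]. *)

(** Equivalence of sets does not determine a dart, since several darts of one tree can carry
    equivalent sets; a dart is determined once its source is known as well. The [V_0]-vertices can
    be recognised across trees, being labelled by the edges of the [sigma j] lying at them. A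
    [V_1]-vertex has no label and must be recovered as the common target of matched darts; that
    targets are respected is the difficult step. Bipartiteness also supplies base points: at a
    vertex of valence two, a base point of the other colour makes the sets of the two darts exact
    complements. As [G] need not be finitely generated, the finiteness needed for sets of half-trees
    comes from the finite path joining two vertices. *)

Set Implicit Arguments.
Unset Strict Implicit.
Unset Printing Implicit Defensive.

Local Open Scope group_scope.
Local Open Scope classical_set_scope.
Local Open Scope card_scope.

(** * Finiteness modulo a subgroup, translates and stabilizers *)

Section FinMod.
Context {G : groupType}.
Implicit Types (A B C H K S : set G) (g h x : G).

Lemma fin_modP H A : fin_mod H A <->
  exists s : seq G, forall x, A x -> exists2 f, f \in s & H (x * f^-1).
Proof.
split=> [[F /finite_seqP[s ->] AF]|[s As]].
  by exists s => x /AF[h Hh [f fs <-]]; exists f; rewrite ?mulgK.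
exists [set` s]; first exact: finite_seq.
move=> x /As[f fs Hx]; exists (x * f^-1) => //; exists f => //.
by rewrite mulgVK.
Qed.

Lemma fin_modS H A B : A `<=` B -> fin_mod H B -> fin_mod H A.
Proof. by move=> AB /fin_modP[s Bs]; apply/fin_modP; exists s => x /AB/Bs. Qed.

Lemma fin_mod0 H : fin_mod H set0.
Proof. by apply/fin_modP; exists [::]. Qed.

Lemma fin_modU H A B : fin_mod H A -> fin_mod H B -> fin_mod H (A `|` B).
Proof.
move=> /fin_modP[s As] /fin_modP[t Bt]; apply/fin_modP; exists (s ++ t).
move=> x [/As|/Bt] [f fs Hx]; exists f => //; rewrite mem_cat fs ?orbT //.
Qed.

Lemma fin_mod_seq H (I : eqType) (s : seq I) (F : I -> set G) :
  (forall i, i \in s -> fin_mod H (F i)) ->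
  fin_mod H [set x | exists2 i, i \in s & F i x].
Proof.
elim: s => [|i s IHs] hF; first by apply: fin_modS (fin_mod0 H) => x [].
apply: (@fin_modS _ _ (F i `|` [set x | exists2 j, j \in s & F j x])).
  move=> x [j]; rewrite inE => /orP[/eqP->|js] Fx; first by left.
  by right; exists j.
apply: fin_modU; first by apply: hF; rewrite mem_head.
by apply: IHs => j js; apply: hF; rewrite inE js orbT.
Qed.

Lemma fin_mod_mulr H A g : fin_mod H A -> fin_mod H [set x | A (x * g)].
Proof.
move=> /fin_modP[s As]; apply/fin_modP; exists [seq f * g^-1 | f <- s].
move=> x /As[f fs Hx]; exists (f * g^-1); first exact: map_f.
by rewrite invgM invgK mulgA.
Qed.

Lemma translateE g A x : translate g A x <-> A (g^-1 * x).
Proof.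
split=> [[y Ay <-]|Ax]; first by rewrite mulKg.
by exists (g^-1 * x); rewrite ?mulVKg.
Qed.

Lemma translateC g A : translate g (~` A) = ~` translate g A.
Proof. by apply/seteqP; split=> x; rewrite /setC /= !translateE. Qed.

Lemma translate1 A : translate 1 A = A.
Proof. by apply/seteqP; split=> x; rewrite translateE invg1 mul1g. Qed.

Lemma translateM g h A : translate (g * h) A = translate g (translate h A).
Proof. by apply/seteqP; split=> x; rewrite !translateE invgM mulgA. Qed.

Lemma StabP A g : Stab A g <-> forall x, A (g * x) <-> A x.
Proof.
split=> [gA x|gA].
  by rewrite -{1}(gA : _ = _) translateE mulKg.
apply/seteqP; split=> x; rewrite translateE; first by move=> /gA; rewrite mulVKg.
by move=> Ax; apply/gA; rewrite mulVKg.
Qed.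

Lemma StabM A g h : Stab A g -> Stab A h -> Stab A (g * h).
Proof. by move=> gA hA; rewrite /Stab /= translateM hA. Qed.

Lemma StabV A g : Stab A g -> Stab A g^-1.
Proof. by move=> gA; rewrite /Stab /= -{1}(gA : _ = _) -translateM mulVg translate1. Qed.

Lemma StabC A : Stab (~` A) = Stab A.
Proof.
apply/seteqP; split=> g; rewrite /Stab /= translateC; last by move=> ->.
by move=> /(congr1 setC); rewrite !setCK.
Qed.

Lemma Stab_translate g A h : Stab (translate g A) h <-> Stab A (g^-1 * h * g).
Proof.
by split=> /StabP Ah; apply/StabP => x;
  [have := Ah (g * x); rewrite !translateE mulKg !mulgA
  |have := Ah (g^-1 * x); rewrite !translateE -!mulgA mulVKg].
Qed.

Lemma fin_mod_translate g A B :
  fin_mod (Stab B) A -> fin_mod (Stab (translate g B)) (translate g A).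
Proof.
move=> /fin_modP[s As]; apply/fin_modP; exists [seq g * f | f <- s].
move=> x /translateE/As[f fs Hx]; exists (g * f); first exact: map_f.
by apply/Stab_translate; rewrite invgM !mulgA -(mulgA _ _ g) mulVg mulg1.
Qed.

(** Nontrivial almost invariant sets over their own stabilizer. The one-sided difference suffices,
    as [g] ranges over a group. *)
Definition nai A :=
  [/\ forall g, fin_mod (Stab A) (A `\` [set x | A (x * g)]),
      ~ fin_mod (Stab A) A & ~ fin_mod (Stab A) (~` A)].

Lemma naiC A : nai A -> nai (~` A).
Proof.
move=> [Aai Ainf Acinf]; split; rewrite ?StabC ?setCK // => g.
apply: fin_modS (fin_mod_mulr g (Aai g^-1)) => x [/= nAx /contrapT Axg].
by split=> //=; rewrite mulgK.
Qed.

(* Choosing a coset [Stab B * g] that misses both [B] and [A] turns a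
   [Stab B]-finite subset of [A] into a finite union of sets
   [A `\` A * c]. *)
Lemma fin_mod_transfer A B S :
  (forall g, fin_mod (Stab A) (A `\` [set x | A (x * g)])) ->
  ~ fin_mod (Stab B) (~` B) -> fin_mod (Stab B) (A `\` B) ->
  S `<=` A -> fin_mod (Stab B) S -> fin_mod (Stab A) S.
Proof.
move=> Aai Bcinf /fin_modP[s ABs] SA /fin_modP[t St].
have [g nBg gs] : exists2 g, ~ B g &
    forall f, f \in s -> ~ Stab B (g * f^-1).
  apply: contrapT => ngs; apply: Bcinf; apply/fin_modP; exists s => x nBx.
  apply: contrapT => nx; apply: ngs; exists x => // f fs Bf.
  by apply: nx; exists f.
have nAg k : Stab B k -> ~ A (k * g).
  move=> Bk Akg; have nB : ~ B (k * g) by move=> /(StabP _ _).1 -/(_ Bk).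
  have [f fs] := ABs _ (conj Akg nB).
  move=> Bf; apply: (gs f fs).
  have := StabM (StabV Bk) Bf.
  by rewrite !mulgA mulVg mul1g.
apply: (@fin_modS _ _ [set x | exists2 f, f \in t &
   (A `\` [set y | A (y * (f^-1 * g))]) x]).
  move=> x Sx; have [f ft Bxf] := St x Sx; exists f => //; split=> /=.
    exact: SA.
  by rewrite mulgA; apply: nAg.
by apply: fin_mod_seq => f _; apply: Aai.
Qed.

End FinMod.

(** * Almost inclusion of nontrivial almost invariant sets *)

Record ais (G : groupType) := Ais { aset :> set G; aisP : nai aset }.

Definition aisC (G : groupType) (A : ais G) : ais G := Ais (naiC (aisP A)).

(* Unlike [ai_le], [ale] allows the opposite corner to be small as well, so it
   is a preorder whose equivalence [aeq] identifies sets with small symmetric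
   difference. *)
Definition ale (G : groupType) (A B : set G) := fin_mod (Stab B) (A `\` B).

Section AlmostInclusion.
Context {G : groupType}.
Implicit Types (A B C D : ais G).

Lemma ais_inj A B : aset A = aset B -> A = B.
Proof.
case: A B => [A hA] [B hB] /= AB; subst B.
by rewrite (Prop_irrelevance hA hB).
Qed.

Lemma aisCK A : aisC (aisC A) = A.
Proof. by apply: ais_inj; rewrite /= setCK. Qed.

(** [fin_mod_transfer] moves finiteness from [Stab B] to [Stab A]; the other direction is the same
    argument for the complements. *)
Lemma ale_l A B : ale A B <-> fin_mod (Stab A) (A `\` B).
Proof.
have h C D : ale C D -> fin_mod (Stab C) (C `\` D).
  move=> CD; have [Cai _ _] := aisP C; have [_ _ Dinf] := aisP D.
  by apply: (fin_mod_transfer Cai Dinf) => // x [].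
split; first exact: h.
move=> AB; have := h (aisC B) (aisC A); rewrite /ale /= !StabC => hBA.
apply: (fin_modS (B := ~` B `\` ~` A)) => [x [Ax nBx]|]; first by split.
by apply/hBA; apply: fin_modS AB => x [nBx /= /contrapT].
Qed.

Lemma aleC A B : ale A B -> ale (aisC B) (aisC A).
Proof.
move=> /ale_l AB; rewrite /ale /= StabC; apply: fin_modS AB.
by move=> x [nB /= /contrapT].
Qed.

Lemma subset_ale A B : A `<=` B -> ale A B.
Proof. by move=> AB; apply: fin_modS (fin_mod0 _) => x [/AB]. Qed.

Lemma ale_refl A : ale A A.
Proof. exact: subset_ale. Qed.

(** Both [A] minus [B] and [B] minus [C] are finite modulo [Stab B], the stabilizer they share;
    their union is then transferred to [Stab A]. *)
Lemma ale_trans B A C : ale A B -> ale B C -> ale A C.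
Proof.
move=> AB BC; have [Aai _ _] := aisP A; have [_ _ Binf] := aisP B.
apply/ale_l; apply: (fin_mod_transfer Aai Binf AB) => [x []//|].
apply: fin_modS (fin_modU AB ((ale_l _ _).1 BC)) => //.
move=> x [Ax nCx]; have [Bx|nBx] := EM (aset B x); first by right.
by left.
Qed.

Lemma ale_contra A B : ale A B -> ale A (aisC B) -> False.
Proof.
move=> /ale_l AB /ale_l AcB; have [_ + _] := aisP A; apply.
apply: fin_modS (fin_modU AB AcB) => x Ax.
by have [Bx|nBx] := EM (aset B x); [right; split => //=|left].
Qed.

Lemma ale_contraC A B : ale A B -> ale (aisC A) B -> False.
Proof. by move=> /aleC BA /aleC; rewrite aisCK => /ale_contra; apply. Qed.

Lemma aleCr A B : ale A (aisC B) -> ale B (aisC A).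
Proof. by move=> /aleC; rewrite aisCK. Qed.

Lemma aleCC A B : ale (aisC A) (aisC B) -> ale B A.
Proof. by move=> /aleC; rewrite !aisCK. Qed.

Definition nestd A B :=
  [\/ ale A B, ale A (aisC B), ale (aisC A) B | ale (aisC A) (aisC B)].

Lemma crossesP A B : crosses A B <-> ~ nestd A B.
Proof.
have sm b c : small_corner b c A B <->
    ale (if b then A else aisC A) (if c then aisC B else B).
  rewrite ale_l /small_corner /corner.
  by case: b c => -[] /=; rewrite ?StabC ?setDE ?setCK.
split=> [AB [] h|nAB b c /sm].
- by apply: (AB true false); apply/sm.
- by apply: (AB true true); apply/sm.
- by apply: (AB false false); apply/sm.
- by apply: (AB false true); apply/sm.
- by case: b c => -[] h; apply: nAB; [apply: Or42|apply: Or41|apply: Or44|apply: Or43].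
Qed.

Definition aeq A B := ale A B /\ ale B A.

Lemma aeq_refl A : aeq A A.
Proof. by split; apply: ale_refl. Qed.

Lemma aeq_sym A B : aeq A B -> aeq B A.
Proof. by case. Qed.

Lemma aeq_trans B A C : aeq A B -> aeq B C -> aeq A C.
Proof. by move=> [AB BA] [BC CB]; split; [apply: ale_trans BC|apply: ale_trans BA]. Qed.

Lemma aeqC A B : aeq A B -> aeq (aisC A) (aisC B).
Proof. by move=> [AB BA]; split; apply: aleC. Qed.

Lemma nestd_aeq A B C D : aeq A C -> aeq B D -> nestd A B -> nestd C D.
Proof.
move=> AC BD.
have [[AC1 CA1] [BD1 DB1]] := (AC, BD).
have [[AC2 CA2] [BD2 DB2]] := (aeqC AC, aeqC BD).
case=> h; [apply: Or41|apply: Or42|apply: Or43|apply: Or44].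
- exact: ale_trans (ale_trans CA1 h) BD1.
- exact: ale_trans (ale_trans CA1 h) BD2.
- exact: ale_trans (ale_trans CA2 h) BD1.
- exact: ale_trans (ale_trans CA2 h) BD2.
Qed.

Lemma nestdCl A B : nestd A B -> nestd (aisC A) B.
Proof.
by case=> h; [apply: Or43|apply: Or44|apply: Or41|apply: Or42]; rewrite ?aisCK.
Qed.

Lemma nestdCr A B : nestd A B -> nestd A (aisC B).
Proof.
by case=> h; [apply: Or42|apply: Or41|apply: Or44|apply: Or43]; rewrite ?aisCK.
Qed.

Lemma ale_translate g A B A' B' : aset A' = translate g A ->
  aset B' = translate g B -> ale A B -> ale A' B'.
Proof.
rewrite /ale => -> -> AB; have := fin_mod_translate g AB.
by apply: fin_modS => x [/translateE Ax nBx]; apply/translateE; split=> // Bx; apply/nBx/translateE.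
Qed.

End AlmostInclusion.

(** * Darts (oriented edges) and their half-trees *)

Section Joined.
Context {V : Type} (r : rel V).

Lemma joined_refl x : joined r x x.
Proof. by exists [::]. Qed.

Lemma joined_rcons x y z : joined r x y -> r y z -> joined r x z.
Proof.
move=> [p xp py] yz; exists (rcons p z); last by rewrite last_rcons.
by rewrite rcons_path xp py.
Qed.

Lemma joined_ind (P : V -> Prop) x y :
  P x -> (forall u w, r u w -> P u -> P w) -> joined r x y -> P y.
Proof.
move=> Px rP [p + <-]; elim: p x Px => //= z p IHp x Px /andP[xz zp].
by apply: IHp => //; apply: rP xz Px.
Qed.

End Joined.

Record dart (G : groupType) (T : ggraph G) :=
  Dart { dval :> T * T; dartP : adj dval.1 dval.2 }.

Section Darts.
Context {G : groupType} {T : ggraph G}.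
Implicit Types e d : dart T.

Definition src e : T := (dval e).1.
Definition tgt e : T := (dval e).2.

Lemma dart_inj e d : src e = src d -> tgt e = tgt d -> e = d.
Proof.
case: e d => [[a b] ab] [[a' b'] ab'] /=; rewrite /src /tgt /= => ea eb.
by subst a' b'; rewrite (bool_irrelevance ab ab').
Qed.

Definition half e : set T := [set w | points_away (dval e) w].

Lemma half_src e : half e (src e).
Proof. exact: joined_refl. Qed.

Lemma half_remove e u w : half e u -> remove_edge (dval e) u w -> half e w.
Proof. exact: joined_rcons. Qed.

Lemma half_step e u w :
  half e u -> adj u w -> half e w \/ u = src e /\ w = tgt e.
Proof.
move=> eu uw; have [uwe|uwe] := eqVneq (u, w) (dval e).
  by right; rewrite /src /tgt -uwe.
have [wue|wue] := eqVneq (w, u) (dval e).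
  by left; have := half_src e; rewrite /src -wue.
by left; apply: half_remove eu _; rewrite /remove_edge /= uw uwe wue.
Qed.

Lemma half_cross e u w : half e u -> ~ half e w -> adj u w ->
  u = src e /\ w = tgt e.
Proof. by move=> eu ew /(half_step eu)[]. Qed.

End Darts.

Section Tree.
Context {G : groupType} {T : gtree G}.
Implicit Types (e d : dart T) (x y u w : T) (g h : G).

Let Tg := gtreeP T.

Lemma actK g x : act g^-1 (act g x) = x.
Proof. by rewrite -(actMg Tg) mulVg (act1g Tg). Qed.

Lemma actVK g x : act g (act g^-1 x) = x.
Proof. by rewrite -(actMg Tg) mulgV (act1g Tg). Qed.

Lemma act_inj g x y : act g x = act g y -> x = y.
Proof. by move=> /(congr1 (act g^-1)); rewrite !actK. Qed.

Lemma rev_subproof e : adj (tgt e, src e).1 (tgt e, src e).2.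
Proof. by rewrite /= (adj_sym Tg); apply: dartP. Qed.

Definition rev e : dart T := Dart (rev_subproof e).

Lemma dact_subproof g e :
  adj (act g (src e), act g (tgt e)).1 (act g (src e), act g (tgt e)).2.
Proof. by rewrite /= (act_adj Tg); apply: dartP. Qed.

Definition dact g e : dart T := Dart (dact_subproof g e).

Lemma src_dact g e : src (dact g e) = act g (src e). Proof. by []. Qed.

Lemma tgt_dact g e : tgt (dact g e) = act g (tgt e). Proof. by []. Qed.

Lemma src_rev e : src (rev e) = tgt e. Proof. by []. Qed.

Lemma tgt_rev e : tgt (rev e) = src e. Proof. by []. Qed.

Lemma revK e : rev (rev e) = e. Proof. exact: dart_inj. Qed.

Lemma rev_inj e d : rev e = rev d -> e = d.
Proof. by move=> /(congr1 rev); rewrite !revK. Qed.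

Lemma dactM g h e : dact (g * h) e = dact g (dact h e).
Proof. by apply: dart_inj; rewrite /src /tgt /= (actMg Tg). Qed.

Lemma dact1 e : dact 1 e = e.
Proof. by apply: dart_inj; rewrite /src /tgt /= (act1g Tg). Qed.

Lemma dactK g e : dact g^-1 (dact g e) = e.
Proof. by rewrite -dactM mulVg dact1. Qed.

Lemma dactVK g e : dact g (dact g^-1 e) = e.
Proof. by rewrite -dactM mulgV dact1. Qed.

Lemma dact_inj g e d : dact g e = dact g d -> e = d.
Proof. by move=> /(congr1 (dact g^-1)); rewrite !dactK. Qed.

Lemma dact_rev g e : dact g (rev e) = rev (dact g e).
Proof. exact: dart_inj. Qed.

Lemma dact_neq_rev g e : dact g e <> rev e.
Proof.
move=> ge; apply: (act_noinv Tg (dartP e) (g := g)); split.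
  exact: (congr1 src ge).
exact: (congr1 tgt ge).
Qed.

(** A simple path from source to target avoiding [e] would close up with [e] to a circuit. *)
Lemma half_tgt e : ~ half e (tgt e).
Proof.
case=> p; case/shortenP => q eq uq _; case: q eq uq => [|z q] eq uq qt.
  by have := dartP e; rewrite -[(dval e).2]qt (negbTE (adj_irr Tg _)).
have ez : path (@adj G T) (dval e).1 (z :: q).
  by apply: sub_path eq => u w /and3P[].
have cyc : ucycleb (@adj G T) ((dval e).1 :: z :: q).
  rewrite /ucycleb uq andbT /cycle rcons_path ez -[last _ _]/(last (dval e).1 (z :: q)).
  by rewrite qt (adj_sym Tg) dartP.
have := tree_acyclic Tg cyc; case: q qt {ez cyc uq} eq => //= -> /andP[].
by rewrite /remove_edge /= -surjective_pairing eqxx andbF.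
Qed.

Lemma half_rev e : half (rev e) = ~` half e.
Proof.
apply/seteqP; split=> w.
  pose P u := ~ half e u.
  apply: (@joined_ind _ _ P) => [|u v uv nu ev]; first exact: half_tgt.
  case/and3P: uv => uv n1 n2.
  have [ve ue] : v = src e /\ u = tgt e.
    by apply: half_cross => //; rewrite (adj_sym Tg).
  by move: n1; rewrite ve ue eqxx.
suff: half e w \/ half (rev e) w by case.
have := tree_connected Tg (src e) w.
apply: (@joined_ind _ _ (fun w => half e w \/ half (rev e) w)).
  by left; apply: half_src.
move=> u v uv [] hu; have [] := half_step hu uv; try by [left|right].
  by case=> _ ->; right; apply: half_src.
by case=> _ ->; left; apply: half_src.
Qed.

Lemma half_revN e w : half (rev e) w <-> ~ half e w.
Proof. by rewrite half_rev. Qed.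

Lemma half_inj e d : half e = half d -> e = d.
Proof.
move=> ed; have [] := @half_cross _ _ d (src e) (tgt e).
- by rewrite -ed; apply: half_src.
- by rewrite -ed; apply: half_tgt.
- exact: dartP.
by move=> *; apply: dart_inj.
Qed.

Lemma half_act g e w : half (dact g e) (act g w) <-> half e w.
Proof.
have h g' e' w' : half e' w' -> half (dact g' e') (act g' w').
  apply: (@joined_ind _ _ (fun w => half (dact g' e') (act g' w))).
    exact: half_src.
  move=> u v /and3P[uv n1 n2] hu.
  have guv : adj (act g' u) (act g' v) by rewrite (act_adj Tg).
  have [//|[]] := half_step hu guv.
  by move=> /act_inj ue /act_inj ve; move: n1; rewrite ue ve /src /tgt -surjective_pairing eqxx.
split; last exact: h.
by move=> /(h g^-1); rewrite actK dactK.
Qed.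

Lemma half_actV g e w : half (dact g e) w <-> half e (act g^-1 w).
Proof. by rewrite -(half_act g e) actVK. Qed.

Lemma sub_half_act g e d :
  half (dact g e) `<=` half (dact g d) <-> half e `<=` half d.
Proof.
by split=> ed w; [move=> /(half_act g)/ed/half_act|move=> /half_actV/ed/half_actV].
Qed.

Lemma separators_finite x y : exists s : seq (T * T),
  forall d, half d x -> ~ half d y -> dval d \in s.
Proof.
have [p + <-] := tree_connected Tg x y.
elim: p x => [|z p IHp] x /=; first by exists [::].
move=> /andP[xz /IHp[s hs]]; exists ((x, z) :: s) => d dx dy.
rewrite inE; have [dz|dz] := EM (half d z); first by rewrite hs ?orbT.
have [xd zd] := half_cross dx dz xz.
by rewrite xd zd /src /tgt -surjective_pairing eqxx.
Qed.

Lemma sub_half_strict_iter g e n : half e `<=` half (dact g e) ->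
  half e `<=` half (dact (g ^+ n) e).
Proof.
move=> ege; elim: n => [|n IHn]; first by rewrite expg0 dact1.
by apply: subset_trans ege _; rewrite expgS dactM sub_half_act.
Qed.

(* A half-tree properly inside its image by [g] has infinitely many images
   under the powers of [g], and only finitely many separate two given points. *)
Lemma half_shift g e x y : half e `<=` half (dact g e) -> dact g e <> e ->
  exists n, ~ (half (dact (g ^+ n) e) x /\ ~ half (dact (g ^+ n) e) y).
Proof.
move=> ege nege; apply: contrapT => /forallNP hn.
have {}hn n : half (dact (g ^+ n) e) x /\ ~ half (dact (g ^+ n) e) y.
  exact: contrapT.
have [s hs] := separators_finite x y.
pose f n := dval (dact (g ^+ n) e).
have finj m n : (m < n)%N -> f m <> f n.
  move=> mn fmn; have {fmn}dmn : dact (g ^+ m) e = dact (g ^+ n) e.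
    by apply: dart_inj; rewrite /src /tgt -!/(f _) fmn.
  apply: nege; apply: half_inj; apply/seteqP; split=> //.
  move: dmn; rewrite -(subnKC mn) addSnnS expgnDr dactM => /dact_inj {2}->.
  by rewrite expgS dactM; apply/sub_half_act/sub_half_strict_iter.
have uniqf : uniq [seq f n | n <- iota 0 (size s).+1].
  rewrite map_inj_uniq ?iota_uniq // => m n fmn.
  by case: (ltngtP m n) => // [/finj|/finj/nesym].
have fs : {subset [seq f n | n <- iota 0 (size s).+1] <= s}.
  by move=> p /mapP[n _ ->]; have [hx hy] := hn n; apply: hs.
by have := uniq_leq_size uniqf fs; rewrite size_map size_iota ltnn.
Qed.

(** [half d] is connected, so a path leaving [half e] inside it would cross [e] with both ends in
    [half d]. *)
Lemma sub_half e d : ~ (half d (src e) /\ half d (tgt e)) ->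
  half e (src d) -> half d `<=` half e.
Proof.
move=> de ed w dw.
suff: half d w /\ half e w by case.
move: dw; apply: (@joined_ind _ _ (fun w => half d w /\ half e w)).
  by split=> //; apply: half_src.
move=> u v duv [du eu]; have dv := half_remove du duv; split=> //.
apply: contrapT => nev; apply: de.
case/and3P: duv => uv _ _.
by have [<- <-] := half_cross eu nev uv.
Qed.

(** The cases are told apart by the ends of [e] lying in [half d]; if [d] separates them, the two
    edges coincide. *)
Lemma half_nested d e :
  [\/ half d `<=` half e, half d `<=` half (rev e),
      half (rev d) `<=` half e | half (rev d) `<=` half (rev e)].
Proof.
have [ds|ds] := EM (half d (src e)); have [dt|dt] := EM (half d (tgt e)).
- have [et|/half_revN et] := EM (half e (tgt d)).
    by apply/Or43/sub_half => //; rewrite half_rev => -[].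
  by apply/Or44/sub_half => //; rewrite half_rev => -[].
- suff -> : e = d by apply: Or41.
  by have [] := half_cross ds dt (dartP e) => *; apply: dart_inj.
- suff -> : e = rev d by rewrite revK; apply: Or42.
  have [] := half_cross dt ds; first by rewrite (adj_sym Tg); apply: dartP.
  by move=> *; apply: dart_inj.
- have [et|/half_revN et] := EM (half e (src d)).
    by apply/Or41/sub_half => // -[].
  by apply/Or42/sub_half => // -[].
Qed.

Lemma sub_half_rev e d : half e `<=` half d <-> half (rev d) `<=` half (rev e).
Proof. by rewrite !half_rev; split=> [/subsetC|/subsetC]; rewrite ?setCK. Qed.

Lemma sub_half_anti e d : half e `<=` half d -> half d `<=` half e -> e = d.
Proof. by move=> ed de; apply/half_inj/seteqP. Qed.

Lemma half_src_tgt e d : half d (src e) -> ~ half d (tgt e) -> e = d.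
Proof.
by move=> ds dt; have [] := half_cross ds dt (dartP e) => *; apply: dart_inj.
Qed.

Lemma sub_src e d : half e `<=` half d -> e <> d -> ~ half e (src d).
Proof.
move=> ed ned es; apply: ned; apply/esym/half_src_tgt => // /ed.
exact: half_tgt.
Qed.

Lemma sub_tgt e d : half e `<=` half d -> e <> d -> half d (tgt e).
Proof.
move=> ed ned; apply: contrapT => dt; apply: ned.
by apply: half_src_tgt => //; apply/ed/half_src.
Qed.

Lemma same_src e d : src e = src d -> e <> d -> half (rev e) `<=` half d.
Proof.
move=> sed ned; apply: sub_half.
  by rewrite -sed half_rev => -[+ _]; apply; apply: half_src.
apply: contrapT => dt; apply: ned; apply: half_src_tgt => //.
by rewrite sed; apply: half_src.
Qed.

Lemma same_tgt e d : tgt e = tgt d -> e <> d -> half e `<=` half (rev d).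
Proof.
move=> ted ned; rewrite -{1}(revK e); apply: same_src => //.
by move=> /rev_inj.
Qed.

Lemma exists_dart_away x y : x <> y -> exists2 d, src d = x & ~ half d y.
Proof.
suff: y = x \/ exists2 d, src d = x & ~ half d y by case=> // ->.
have := tree_connected Tg x y.
apply: (@joined_ind _ _ (fun y => y = x \/ exists2 d, src d = x & ~ half d y)).
  by left.
move=> u w uw [ux|[d dx du]].
  subst u; right; exists (Dart (uw : adj (x, w).1 (x, w).2)) => //.
  exact: half_tgt.
have [->|wx] := EM (w = x); first by left.
right; exists d => // dw; apply: wx; rewrite -dx.
by have [] := half_cross dw du; first by rewrite (adj_sym Tg).
Qed.

End Tree.

(** A circuit through the edge from [x] to [y] leaves [Z] along it and could return only from [y],
    which it does not visit twice. *)
Lemma acyclic_of_cuts (G : groupType) (T : ggraph G) :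
  (forall x y : T, adj x y = adj y x) ->
  (forall x y : T, adj x y -> exists Z : T -> Prop, [/\ Z x, ~ Z y &
     forall u w, adj u w -> Z u -> ~ Z w -> u = x /\ w = y]) ->
  forall c : seq T, ucycleb (@adj G T) c -> (size c <= 2)%N.
Proof.
move=> adjC cuts [|x [|y [|z r]]] //.
rewrite /ucycleb => /andP[]; rewrite /cycle => /andP[xy /andP[yz zr]] uniqc.
have [Z [Zx Zy Zcross]] := cuts x y xy; exfalso.
have nZ u w : adj u w -> ~ Z u -> Z w -> u = y /\ w = x.
  by rewrite adjC => wu Zu Zw; have [-> ->] := Zcross _ _ wu Zw Zu.
have Zz : ~ Z z.
  move=> Zz; have [_ zx] := nZ _ _ yz Zy Zz.
  by move: uniqc; rewrite zx /= !inE eqxx orbT.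
have ny : all (predC1 y) (z :: r).
  by apply/allP => u ur; move: uniqc => /and3P[_ yr _]; apply: contraNneq yr => <-.
elim: r z zr Zz ny {uniqc yz} => [|u r IHr] z /=.
  by move=> /andP[zx _] Zz /andP[/eqP + _]; have [] := nZ _ _ zx Zz Zx.
move=> /andP[zu ur] Zz /andP[/eqP zy ny]; apply: IHr ur _ ny => Zu.
by have [] := nZ _ _ zu Zz Zu.
Qed.

(** * Collapsing maps between trees *)

Record collapsing (G : groupType) (U S : gtree G) (q : U -> S) : Prop := {
  collapsing_act : forall g x, q (act g x) = act g (q x);
  collapsing_surj : forall y, exists x, q x = y;
  collapsing_adj : forall x y, adj x y -> q x = q y \/ adj (q x) (q y);
  collapsing_uniq : forall e d : dart U, q (src e) <> q (tgt e) ->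
    q (src d) = q (src e) -> q (tgt d) = q (tgt e) -> d = e;
  collapsing_lift : forall c : dart S, exists e : dart U,
    q (src e) = src c /\ q (tgt e) = tgt c
}.

Section Collapsing.
Context {G : groupType} {U S : gtree G} (q : U -> S).
Hypothesis hq : collapsing q.

Lemma src_neq_tgt (T : gtree G) (e : dart T) : src e <> tgt e.
Proof. by move=> st; apply: (half_tgt (e := e)); rewrite -st; apply: half_src. Qed.

(** A path avoiding [e] maps to a path never traversing [c], because [e] is the only lift of [c]. *)
Lemma collapsing_half (e : dart U) (c : dart S) :
  q (src e) = src c -> q (tgt e) = tgt c ->
  forall w, half c (q w) <-> half e w.
Proof.
have h (e' : dart U) (c' : dart S) : q (src e') = src c' ->
    q (tgt e') = tgt c' -> forall w, half e' w -> half c' (q w).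
  move=> es et w; apply: (@joined_ind _ _ (fun w => half c' (q w))).
    by rewrite -/(src e') es; apply: half_src.
  move=> u v /and3P[uv n1 _] hu; have [<-//|quv] := collapsing_adj hq uv.
  have [//|[qu qv]] := half_step hu quv.
  have e'E : Dart (uv : adj (u, v).1 (u, v).2) = e'.
    apply: (collapsing_uniq hq); first by rewrite es et; apply: src_neq_tgt.
      by rewrite es.
    by rewrite et.
  by move: n1; rewrite -e'E /= eqxx.
move=> es et w; split; last exact: h.
move=> cw; apply: contrapT => /half_revN ew.
by have /half_revN := h (rev e) (rev c) et es w ew.
Qed.

End Collapsing.

Section CollapseTree.
Context {G : groupType} (T : gtree G) (E : rel T).
Hypothesis Eadj : forall x y, E x y -> adj x y.
Hypothesis Eact : forall g x y, E (act g x) (act g y) = E x y.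

Let Tg := gtreeP T.

Lemma to_collapseP (x y : T) :
  to_collapse E x = to_collapse E y <-> joined (symE E) x y.
Proof.
split=> [/eqP|xy]; first by rewrite /to_collapse eqmodE => /asboolP.
by apply/eqP; rewrite /to_collapse eqmodE; apply/asboolP.
Qed.

Lemma to_collapse_surj (a : collapse E) : exists x, to_collapse E x = a.
Proof. by exists (repr a); apply: reprK. Qed.

Lemma symE_adj x y : symE E x y -> adj x y.
Proof. by rewrite /symE /= => /orP[/Eadj//|/Eadj]; rewrite (adj_sym Tg). Qed.

Lemma symEC x y : symE E x y = symE E y x.
Proof. by rewrite /symE /= orbC. Qed.

Lemma symE_act g x y : symE E (act g x) (act g y) = symE E x y.
Proof. by rewrite /symE /= !Eact. Qed.

Lemma act_to_collapse g x :
  act g (to_collapse E x : collapse E) = to_collapse E (act g x).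
Proof.
rewrite /= to_collapseP.
have : joined (symE E) (repr (to_collapse E x)) x.
  by rewrite -to_collapseP; apply: reprK.
move: (repr _) => y [p rp <-]; exists (map (act g) p); last by rewrite last_map.
by rewrite path_map; apply: sub_path rp => u v uv; exact: etrans (symE_act g u v) uv.
Qed.

(** Paths of collapsed edges do not cross a surviving edge, so its half-trees are unions of classes.
    Their images are the cuts that make the collapse acyclic. *)
Lemma half_collapse (e : dart T) x y : ~~ symE E (src e) (tgt e) ->
  to_collapse E x = to_collapse E y -> half e x <-> half e y.
Proof.
have h u v : ~~ symE E (src e) (tgt e) -> joined (symE E) u v ->
    half e u -> half e v.
  move=> nE uv eu; move: uv; apply: joined_ind => // a b ab ea.
  have [//|[ae be]] := half_step ea (symE_adj ab).
  by move: nE; rewrite -ae -be ab.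
move=> nE xy; split; apply: h => //; first exact/to_collapseP.
exact/to_collapseP.
Qed.

Lemma collapse_uniq (e d : dart T) : ~~ symE E (src e) (tgt e) ->
  to_collapse E (src d) = to_collapse E (src e) ->
  to_collapse E (tgt d) = to_collapse E (tgt e) -> d = e.
Proof.
move=> nE ds dt; apply: half_src_tgt.
  by apply/(half_collapse nE ds)/half_src.
by move=> /(half_collapse nE dt)/half_tgt.
Qed.

Lemma collapse_adjP (a b : collapse E) : adj a b <-> exists e : dart T,
  [/\ to_collapse E (src e) = a, to_collapse E (tgt e) = b &
      ~~ symE E (src e) (tgt e)].
Proof.
split=> [/asboolP[x [y [xa yb xy nE]]]|[e [ea eb nE]]].
  by exists (Dart (xy : adj (x, y).1 (x, y).2)).
by apply/asboolP; exists (src e), (tgt e); split=> //; apply: dartP.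
Qed.

Lemma collapse_step x y : adj x y ->
  to_collapse E x = to_collapse E y \/ 
  adj (to_collapse E x : collapse E) (to_collapse E y).
Proof.
move=> xy; have [Exy|nE] := boolP (symE E x y).
  by left; apply/to_collapseP; exists [:: y]; rewrite //= Exy.
by right; apply/collapse_adjP; exists (Dart (xy : adj (x, y).1 (x, y).2)).
Qed.

Lemma collapse_adj_sym (a b : collapse E) : adj a b = adj b a.
Proof.
suff h (c d : collapse E) : adj c d -> adj d c by apply/idP/idP; apply: h.
move=> /collapse_adjP[e [ec ed nE]]; apply/collapse_adjP; exists (rev e).
by split=> //=; rewrite symEC.
Qed.

Lemma collapse_act_adj g (a b : collapse E) : adj a b -> adj (act g a) (act g b).
Proof.
move=> /collapse_adjP[e [<- <- nE]]; apply/collapse_adjP; exists (dact g e).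
by rewrite !act_to_collapse symE_act; split.
Qed.

Lemma collapse_is_gtree : is_gtree (collapse E).
Proof.
have act1 (a : collapse E) : act 1 a = a.
  have [x <-] := to_collapse_surj a.
  by rewrite act_to_collapse (act1g Tg).
have actM g h (a : collapse E) : act (g * h) a = act g (act h a).
  have [x <-] := to_collapse_surj a.
  by rewrite !act_to_collapse (actMg Tg).
split=> //.
- move=> g a b; apply/idP/idP; last exact: collapse_act_adj.
  by move=> /(collapse_act_adj g^-1); rewrite -!actM mulVg !act1.
- exact: collapse_adj_sym.
- move=> a; apply/negP => /collapse_adjP[e [ea eb nE]].
  apply: (half_tgt (e := e)); apply/(half_collapse nE (eq_trans eb (esym ea))).
  exact: half_src.
- by have [x _] := tree_inhabited Tg; exists (to_collapse E x).
- move=> a b; have [x <-] := to_collapse_surj a.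
  have [y <-] := to_collapse_surj b.
  have := tree_connected Tg x y.
  apply: (@joined_ind _ _ (fun y =>
    joined (@adj G (collapse E)) (to_collapse E x) (to_collapse E y))).
    exact: joined_refl.
  move=> u v /collapse_step[->//|uv] xu; exact: joined_rcons xu uv.
- apply: acyclic_of_cuts; first exact: collapse_adj_sym.
  move=> a b /collapse_adjP[e [ea eb nE]].
  exists (fun c => exists2 x, to_collapse E x = c & half e x); split.
  + by exists (src e) => //; apply: half_src.
  + move=> [x xb ex]; apply: (half_tgt (e := e)).
    by apply/(half_collapse nE (eq_trans eb (esym xb))).
  + move=> u v /collapse_adjP[d [<- <- _]] [x xd ex] dv.
    have ed : half e (src d) by apply/(half_collapse nE (esym xd)).
    rewrite (half_src_tgt ed) //.
    by move=> edt; apply: dv; exists (tgt d).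
- move=> g a b /collapse_adjP[e [<- <- nE]]; rewrite !act_to_collapse => -[h1 h2].
  apply: (dact_neq_rev (g := g) (e := e)); apply: collapse_uniq => //=.
  by rewrite symEC.
Qed.

Lemma collapsing_giso (S : gtree G) (f : collapse E -> S) : giso f ->
  collapsing (fun x => f (to_collapse E x)).
Proof.
move=> [[f' fK f'K] fact fadj]; split.
- by move=> g x; rewrite -fact act_to_collapse.
- move=> y; have [x xy] := to_collapse_surj (f' y); exists x.
  by rewrite xy f'K.
- by move=> x y /collapse_step[->|xy]; [left|right; rewrite fadj].
- move=> e d nq /(can_inj fK) qs /(can_inj fK) qt; apply: collapse_uniq => //.
  apply/negP => Ee; apply: nq; congr f; apply/to_collapseP.
  by exists [:: tgt e]; rewrite //= Ee.
- move=> c; have : adj (f' (src c)) (f' (tgt c)) by rewrite -fadj !f'K; apply: dartP.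
  by move=> /collapse_adjP[e [es et _]]; exists e; rewrite es et !f'K.
Qed.

End CollapseTree.

(** * Minimality in the form used below: every orbit meets both sides of every edge *)

Definition hull (G : groupType) (T : gtree G) : Prop :=
  forall (e : dart T) (v : T), exists g, half e (act g v).

(** If all translates of [half e] miss [v], the vertices outside them form an invariant subtree that
    contains [v] but not [src e]. *)
Lemma minimal_hull (G : groupType) (T : gtree G) : minimal_gtree T -> hull T.
Proof.
move=> minT e v; apply: contrapT => /forallNP nev.
pose S : set T := [set x | forall g, ~ half (dact g e) x].
have ST : S = setT.
  apply: minT; last by move=> g x Sx h hgx; apply: (Sx (g^-1 * h)); rewrite dactM half_actV invgK.
  split; first by exists v => g; rewrite half_actV; apply: nev.
  move=> x y /set_mem Sx /set_mem Sy.
  pose r : rel T := [rel u v | [&& u \in S, v \in S & adj u v]].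
  (* A path between points of [S] may run through a translate of [half e], but it enters and leaves
     through the same vertex [tgt (dact g e)]. *)
  pose P w := S w /\ joined r x w \/
    exists g, [/\ half (dact g e) w, S (tgt (dact g e)) & joined r x (tgt (dact g e))].
  suff : P y by case=> [[]//|[g [/Sy]]].
  have := tree_connected (gtreeP T) x y.
  apply: (@joined_ind _ _ P); first by left; split=> //; apply: joined_refl.
  move=> u w uw [[Su xu]|[g [gu Sg xg]]].
    have [Sw|nSw] := EM (S w).
      left; split=> //; apply: joined_rcons xu _.
      by rewrite /r /= uw !mem_set.
    have [g gw] : exists g, half (dact g e) w by apply: contrapT => /forallNP.
    have [_ ug] : w = src (dact g e) /\ u = tgt (dact g e).
      by apply: half_cross (Su g) _ => //; rewrite (adj_sym (gtreeP T)).
    by right; exists g; rewrite -ug.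
  have [gw|[_ ->]] := half_step gu uw; first by right; exists g.
  by left.
have : S (src e) by rewrite ST.
by move=> /(_ 1); rewrite dact1; apply; apply: half_src.
Qed.

Lemma splitting_darts (G : groupType) (s : splitting G) (c d : dart s) :
  exists g, d = dact g c \/ d = rev (dact g c).
Proof.
have [a [b [ab hab]]] := splitting_one_edge s.
pose e := Dart (ab : adj (a, b).1 (a, b).2).
have h (c' : dart s) : exists g, c' = dact g e \/ c' = rev (dact g e).
  have := hab _ _ (dartP c'); rewrite /edge_orbit /= => /asboolP[] [g _ /= [ga gb]].
    by exists g; left; apply: dart_inj; rewrite /src /tgt /= ?ga ?gb.
  by exists g; right; apply: dart_inj; rewrite /src /tgt /= ?ga ?gb.
have [[g gc] [k kd]] := (h c, h d); exists (k * g^-1).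
case: gc kd => -> [] ->; rewrite ?dact_rev !dactM ?dact_rev dactK ?revK; by [left|right].
Qed.

(** Here the absence of a fixed vertex replaces minimality: the dart leaving [v] towards another
    point of its orbit has orbit points on both sides, and up to reversal it is a translate of
    [e]. *)
Lemma splitting_hull (G : groupType) (s : splitting G) : hull s.
Proof.
move=> e v; apply: contrapT => /forallNP nev.
have [g gv] := splitting_nofix v.
have [d dv dgv] := exists_dart_away (nesym gv).
have vd : half d v by rewrite -dv; apply: half_src.
have [h [] hd] := splitting_darts e d; subst d.
  by apply: (nev h^-1); apply/half_actV.
apply: dgv; apply/half_revN; rewrite half_actV -(actMg (gtreeP s)).
exact: nev.
Qed.

Record mtree (G : groupType) := MTree {
  mtree_tree :> gtree G;
  mtreeP : hull mtree_tree
}.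

Definition msplit (G : groupType) (s : splitting G) : mtree G :=
  MTree (splitting_hull (s := s)).

(** * The almost invariant set of a dart *)

Section HalfAis.
Context {G : groupType} {T : mtree G}.
Implicit Types (e d : dart T) (v w : T) (g h : G).

Let Tg := gtreeP T.

Definition orbit_half e v : set G := [set g | half e (act g v)].
Definition dstab e : set G := [set g | dact g e = e].

Lemma orbit_half_translate g e v :
  translate g (orbit_half e v) = orbit_half (dact g e) v.
Proof.
apply/seteqP; split=> x; rewrite translateE /orbit_half /= half_actV -(actMg Tg) //.
Qed.

(** Otherwise all the darts [dact (g ^+ n) e] would separate [act a v] from [act b v], against
    [half_shift]. *)
Lemma orbit_half_neq g e v : half e `<=` half (dact g e) -> dact g e <> e ->
  orbit_half (dact g e) v <> orbit_half e v.
Proof.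
move=> ege nege oe.
have [[a ea] [b /half_revN eb]] := (mtreeP e v, mtreeP (rev e) v).
have on n : orbit_half (dact (g ^+ n) e) v = orbit_half e v.
  elim: n => [|n IHn]; first by rewrite expg0 dact1.
  by rewrite expgS dactM -orbit_half_translate IHn orbit_half_translate.
have [n] := half_shift (act a v) (act b v) ege nege; apply.
split; first by have : orbit_half e v a := ea; rewrite -(on n).
by move=> gb; apply: eb; have : orbit_half (dact (g ^+ n) e) v b := gb; rewrite on.
Qed.

(** The condition on stabilizers in [arises_from] is therefore automatic. If [g] fixed the set but
    moved [e], two of the four nestings of [e] with its translate would contradict [orbit_half_neq],
    the other two the orbit points on the two sides of [e]. *)
Lemma Stab_orbit_half e v : Stab (orbit_half e v) = dstab e.
Proof.
apply/seteqP; split=> g; rewrite /Stab /dstab /= orbit_half_translate; last by move=> ->.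
move=> oe; apply: contrapT => nege.
have [[a ea] [b /half_revN eb]] := (mtreeP e v, mtreeP (rev e) v).
have oeP x : half (dact g e) (act x v) <-> half e (act x v).
  by rewrite -[half e _]/(orbit_half e v x) -oe.
have [] := half_nested (dact g e) e => sub.
- apply: (@orbit_half_neq g^-1 e v); rewrite ?dactK //.
  + by rewrite -(sub_half_act g) dactVK.
  + by move=> eg; apply: nege; rewrite -{1}eg dactVK.
  + by rewrite -orbit_half_translate -{1}oe orbit_half_translate dactK.
- by have /half_revN /(_ ea) := sub _ ((oeP a).2 ea).
- by apply: (eb); apply/sub/half_revN => /oeP.
- by apply: (@orbit_half_neq g e v) => //; apply/sub_half_rev.
Qed.

(** [e] separates the translates of [v] and [w] by [g] exactly when [dact g^-1 e] separates [v] from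
    [w]. Finitely many darts do so, and each accounts for one coset of [dstab e]. *)
Lemma fin_mod_separated e v w :
  fin_mod (dstab e) [set g | half e (act g v) /\ ~ half e (act g w)].
Proof.
have [s hs] := separators_finite v w.
pose F (p : T * T) := [set g | dval (dact g^-1 e) = p].
apply: (@fin_modS _ _ _ [set g | exists2 p, p \in s & F p g]).
  move=> g [gv gw]; exists (dval (dact g^-1 e)) => //.
  by apply: hs; rewrite half_actV invgK.
apply: fin_mod_seq => p _.
have [[g0 hg0]|/forallNP nF] := EM (exists g0, F p g0); last first.
  by apply: fin_modS (fin_mod0 _) => g /nF.
apply/fin_modP; exists [:: g0] => g hg; exists g0; first by rewrite mem_head.
rewrite /dstab /= dactM; have -> : dact g0^-1 e = dact g^-1 e.
  by apply: dart_inj; rewrite /src /tgt hg0 hg.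
exact: dactVK.
Qed.

(** A translate of [e] on a given side of [e] either points the same way as [e], which gives the
    expansion, or the opposite way. If opposite ones occur on both sides, the product of the two
    elements does the job. *)
Lemma exists_expand e :
  exists2 g, half e `<=` half (dact g e) & dact g e <> e.
Proof.
have aux d : (exists2 g, half d `<=` half (dact g d) & dact g d <> d) \/
    exists g, half (rev (dact g d)) `<=` half d.
  have [g dg] := mtreeP d (tgt d).
  have ngd : dact g d <> d.
    by move=> gd; apply: (half_tgt (e := d)); rewrite -{2}gd.
  have [] := half_nested (dact g d) d => sub.
  - left; exists g^-1; first by rewrite -(sub_half_act g) dactVK.
    by move=> gd; apply: ngd; rewrite -{1}gd dactVK.
  - exfalso; apply: (dact_neq_rev (g := g) (e := d)); apply: rev_inj; rewrite revK.
    apply: half_src_tgt; first exact: dg.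
    by move=> sd; have /half_revN /(_ sd) := sub _ (half_src (dact g d)).
  - by right; exists g.
  - by left; exists g => //; apply/sub_half_rev.
have [//|[g ge]] := aux e; have [[h he nhe]|[h he]] := aux (rev e).
  exists h^-1; last by move=> hE; apply: nhe; rewrite dact_rev -{1}hE dactVK.
  by rewrite -(sub_half_act h) dactVK; apply/sub_half_rev; rewrite -dact_rev.
have ghe : half (dact (g * h) e) `<=` half e.
  apply: subset_trans ge; rewrite dactM -dact_rev sub_half_act.
  by move: he; rewrite dact_rev revK.
exists (g * h)^-1; first by rewrite -(sub_half_act (g * h)) dactVK.
move=> /(congr1 (dact (g * h))); rewrite dactVK => ghE.
apply: (dact_neq_rev (g := g) (e := e)); apply: rev_inj; rewrite revK.
apply: sub_half_anti => //; rewrite {1}ghE dactM -dact_rev sub_half_act.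
by move: he; rewrite dact_rev revK.
Qed.

(** Orbit points arbitrarily deep in [half e] are cut off from [tgt e] by many translates of [e],
    while the finitely many cosets bound the number of separating darts. *)
Lemma orbit_half_infinite e v : ~ fin_mod (dstab e) (orbit_half e v).
Proof.
move=> /fin_modP[s hs].
have [g] := exists_expand (rev e); rewrite dact_rev => ege nege.
have {nege ege} [ege nege] : half (dact g e) `<=` half e /\ dact g e <> e.
  by split; [apply/sub_half_rev|move=> gE; apply: nege; rewrite gE].
have [S hS] := choice (fun f => separators_finite (act f v) (tgt e)).
(* The [N.+1] nested darts [dact (g ^+ i) e] with [i <= N], moved by [k^-1], would all lie in one
   list [S f] of length at most [N]. *)
pose N := \max_(f <- s) size (S f).
have [x0 hx0] := mtreeP (dact (g ^+ N) e) v.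
have sub m n : (m <= n)%N -> half (dact (g ^+ n) e) `<=` half (dact (g ^+ m) e).
  move=> mn; rewrite -(subnKC mn) expgnDr dactM sub_half_act.
  elim: (n - m)%N => [|k IHk]; first by rewrite expg0 dact1.
  by apply: subset_trans ege; rewrite expgS dactM sub_half_act.
have x0e : half e (act x0 v) by move: hx0 => /(sub 0%N N (leq0n _)); rewrite expg0 dact1.
have [f fs kf] := hs x0 x0e.
set k := x0 * f^-1 in kf; have x0E : x0 = k * f by rewrite mulgVK.
have ksep i : (i <= N)%N -> dval (dact (k^-1 * g ^+ i) e) \in S f.
  move=> iN; apply: hS.
    rewrite dactM half_actV invgK -(actMg Tg) -x0E; exact: (sub i N).
  rewrite dactM half_actV invgK.
  have -> : act k (tgt e) = tgt e by have /(congr1 tgt) := kf.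
  by move=> /(sub 0%N i (leq0n _)); rewrite expg0 dact1; apply: half_tgt.
have finj m n : (m < n)%N -> dact (g ^+ m) e <> dact (g ^+ n) e.
  move=> mn mnE; apply: nege; apply: sub_half_anti => //.
  rewrite -(sub_half_act (g ^+ m)) -dactM -expgSr mnE; exact: sub.
pose r := [seq dval (dact (k^-1 * g ^+ i) e) | i <- iota 0 N.+1].
have uniqr : uniq r.
  rewrite map_inj_uniq ?iota_uniq // => m n mnE.
  have {mnE}: dact (g ^+ m) e = dact (g ^+ n) e.
    by apply: (dact_inj (g := k^-1)); rewrite -!dactM; apply: dart_inj; rewrite /src /tgt mnE.
  by case: (ltngtP m n) => // [/finj|/finj/nesym].
have rS : {subset r <= S f}.
  by move=> p /mapP[i]; rewrite mem_iota add0n ltnS /= => iN ->; apply: ksep.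
have := uniq_leq_size uniqr rS; rewrite size_map size_iota ltnNge => /negP; apply.
exact: leq_bigmax_seq.
Qed.

Lemma dstab_rev e : dstab (rev e) = dstab e.
Proof.
by apply/seteqP; split=> g; rewrite /dstab /= dact_rev; [apply: rev_inj|move=> ->].
Qed.

Lemma orbit_half_rev e v : orbit_half (rev e) v = ~` orbit_half e v.
Proof. by rewrite /orbit_half half_rev. Qed.

Lemma orbit_half_nai e v : nai (orbit_half e v).
Proof.
split; rewrite ?Stab_orbit_half.
- move=> g; apply: fin_modS (fin_mod_separated e v (act g v)) => x [/= xv xgv].
  by split; rewrite // -(actMg Tg).
- exact: orbit_half_infinite.
- by rewrite -orbit_half_rev -dstab_rev; apply: orbit_half_infinite.
Qed.

Definition aisV e v : ais G := Ais (orbit_half_nai e v).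
Definition base : T := sval (cid (tree_inhabited Tg)).
Definition aisX e := aisV e base.

Lemma aisV_base e v w : aeq (aisV e v) (aisV e w).
Proof.
by split; rewrite /ale /= Stab_orbit_half;
  [apply: fin_modS (fin_mod_separated e v w)
  |apply: fin_modS (fin_mod_separated e w v)].
Qed.

Lemma aisV_rev e v : aisV (rev e) v = aisC (aisV e v).
Proof. by apply: ais_inj; rewrite /= orbit_half_rev. Qed.

Lemma aisX_rev e : aisX (rev e) = aisC (aisX e).
Proof. exact: aisV_rev. Qed.

Lemma aisX_act g e : aset (aisX (dact g e)) = translate g (aisX e).
Proof. by rewrite /= orbit_half_translate. Qed.

Lemma aisX_sub e d : half e `<=` half d -> ale (aisX e) (aisX d).
Proof. by move=> ed; apply: subset_ale => g /ed. Qed.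

(** The second alternative covers distinct equivalent darts, whose order the sets do not see. *)
Lemma aisX_le e d : ale (aisX e) (aisX d) -> 
  half e `<=` half d \/ half d `<=` half e.
Proof.
move=> ed; have [] := half_nested e d => sub; first by left.
- by have := aisX_sub sub; rewrite aisX_rev => /(ale_contra ed).
- by have := aisX_sub sub; rewrite aisX_rev => /(ale_contraC ed).
- by right; apply/sub_half_rev.
Qed.

End HalfAis.

(** * Vertices of valence two, and sets lying at a vertex *)

Definition valence2 (G : groupType) (T : gtree G) (e1 e2 : dart T) :=
  [/\ e1 <> e2, src e1 = src e2 & forall d, src d = src e1 -> d = e1 \/ d = e2].

Lemma valence2_sym (G : groupType) (T : gtree G) (e1 e2 : dart T) :
  valence2 e1 e2 -> valence2 e2 e1.
Proof.
move=> [n12 s12 h]; split=> // [/esym//|d]; rewrite -s12 => /h[]; by [right|left].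
Qed.

Lemma valence2_half (G : groupType) (T : gtree G) (e1 e2 : dart T) w :
  valence2 e1 e2 -> half e2 w -> w <> src e1 ->
  half (rev e1) w.
Proof.
move=> [_ s12 h] e2w /nesym/exists_dart_away[d /h[->|->]] dw //.
exact/half_revN.
Qed.

Section AtVertex.
Context {G : groupType} {T : mtree G}.
Implicit Types (e d f : dart T) (v w : T) (A : ais G).

(** The half-trees of [e2] and [rev e1] differ only in the vertex [src e1], which the orbit of the
    base point [u] avoids. *)
Lemma valence2_aeq e1 e2 u : valence2 e1 e2 -> (forall g, act g u <> src e1) ->
  aeq (aisX e2) (aisC (aisX e1)).
Proof.
move=> v12 nu; rewrite -aisX_rev.
apply: aeq_trans (aisV_base _ _ u) (aeq_trans _ (aisV_base _ u _)).
split; apply: subset_ale => g /=.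
  by move=> e2g; apply: valence2_half v12 _ _ => //; apply: nu.
by case: v12 => n12 s12 _; apply: same_src.
Qed.

(* A third dart [g] at [src d] would cut off a half-tree lying below both
   [aisX e] and its complement. *)
Lemma aeq_valence2 e d : aeq (aisX e) (aisX d) -> half e `<=` half d -> e <> d ->
  exists2 f, valence2 d f & ~ half f (src e).
Proof.
move=> [_ de] sub ned; have ned' := sub_src sub ned.
have [f fd fe] : exists2 f, src f = src d & ~ half f (src e).
  by apply: exists_dart_away => sde; apply: ned'; rewrite sde; apply: half_src.
exists f => //; split=> // [dfE|g gd].
  by apply: fe; rewrite -dfE; apply/sub/half_src.
have [->|ngd] := EM (g = d); first by left.
have [->|ngf] := EM (g = f); first by right.
exfalso; have rgd := aisX_sub (same_src gd ngd).
apply: (ale_contra (ale_trans rgd de)); rewrite -aisX_rev; apply: aisX_sub.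
apply/sub_half_rev; rewrite !revK; apply: sub_half; first by rewrite gd => -[].
apply: (same_src (e := f)); first by rewrite fd gd.
  by move=> fg; apply: ngf.
exact/half_revN.
Qed.

Definition at_vertex v A := forall e, half e v ->
  ale (aisC (aisX e)) A \/ ale (aisC (aisX e)) (aisC A).

Lemma at_vertex_aeq v A B : aeq A B -> at_vertex v A -> at_vertex v B.
Proof.
move=> AB vA e /vA[h|h]; first by left; apply: ale_trans h AB.1.
by right; apply: ale_trans h (aeqC AB).1.
Qed.

Lemma aeq_of_both_sides e A :
  ale (aisX e) A \/ ale (aisX e) (aisC A) ->
  ale (aisC (aisX e)) A \/ ale (aisC (aisX e)) (aisC A) ->
  aeq A (aisX e) \/ aeq A (aisC (aisX e)).
Proof.
move=> [h1|h1] [h2|h2].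
- by case: (ale_contraC h1 h2).
- by left; split=> //; apply: aleCC.
- by right; split=> //; apply: aleCr.
- by case: (ale_contraC h1 h2).
Qed.

Lemma at_vertex_separated e v w A : half e v -> ~ half e w ->
  at_vertex v A -> at_vertex w A -> aeq A (aisX e) \/ aeq A (aisC (aisX e)).
Proof.
move=> ev /half_revN ew vA wA; apply: aeq_of_both_sides; last exact: vA.
by have := wA _ ew; rewrite aisX_rev aisCK.
Qed.

(** The sides of [e1] and [e2] away from the vertex are complementary up to [aeq], so [A] is
    comparable with both sides of [e1]. *)
Lemma at_vertex_valence2 e1 e2 u A : valence2 e1 e2 ->
  (forall g, act g u <> src e1) -> at_vertex (src e1) A ->
  aeq A (aisX e1) \/ aeq A (aisC (aisX e1)).
Proof.
move=> v12 nu vA; have [_ s12 _] := v12.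
have [h12 h21] := aeqC (valence2_aeq v12 nu).
rewrite aisCK in h12 h21.
apply: aeq_of_both_sides; last by apply: vA; apply: half_src.
have [|h|h] := vA e2; first by rewrite s12; apply: half_src.
  by left; apply: ale_trans h21 h.
by right; apply: ale_trans h21 h.
Qed.

Lemma aisX_same_src e d : src e = src d -> ale (aisX e) (aisX d) -> e = d.
Proof.
move=> sed /aisX_le[sub|sub]; apply: contrapT => ned.
  by apply: (sub_src sub ned); rewrite -sed; apply: half_src.
by apply: (sub_src sub (nesym ned)); rewrite sed; apply: half_src.
Qed.

End AtVertex.

Lemma aisX_ale_act (G : groupType) (S T : mtree G) (c : dart S) (d : dart T) g :
  ale (aisX c) (aisX d) -> ale (aisX (dact g c)) (aisX (dact g d)).
Proof. by apply: ale_translate; apply: aisX_act. Qed.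

Lemma aisX_aeq_act (G : groupType) (S T : mtree G) (c : dart S) (d : dart T) g :
  aeq (aisX c) (aisX d) -> aeq (aisX (dact g c)) (aisX (dact g d)).
Proof. by move=> [? ?]; split; apply: aisX_ale_act. Qed.

Lemma aisX_nestd_act (G : groupType) (S T : mtree G) (c : dart S) (d : dart T) g :
  nestd (aisX c) (aisX d) -> nestd (aisX (dact g c)) (aisX (dact g d)).
Proof.
by case=> h; [apply: Or41|apply: Or42|apply: Or43|apply: Or44];
  rewrite -?aisX_rev -?dact_rev; apply: aisX_ale_act; rewrite ?aisX_rev.
Qed.

(** * Crossing and sandwiching of splittings in terms of darts *)

Section SplittingAis.
Context {G : groupType}.
Implicit Types s t : splitting G.

Lemma splitting_dart s : exists c : dart (msplit s), True.
Proof.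
have [a [b [ab _]]] := splitting_one_edge s.
by exists (Dart (ab : adj (a, b).1 (a, b).2)).
Qed.

Lemma arises_from_orbit_half s (X : set G) : arises_from s X <->
  exists (c : dart (msplit s)) (v : msplit s), X = orbit_half c v.
Proof.
have SE (c : dart (msplit s)) : Stab_edge (dval c) = dstab c.
  apply/seteqP; split=> g; rewrite /Stab_edge /dstab /=.
    by case=> h1 h2; apply: dart_inj.
  by move=> h; split; [exact: (congr1 src h)|exact: (congr1 tgt h)].
split=> [[v [e [ea -> _]]]|[c [v ->]]]; first by exists (Dart ea), v.
by exists v, (dval c); split=> //; [apply: dartP|rewrite Stab_orbit_half SE].
Qed.

(** The definition tests one set against the translates of another; since each tree has one orbit of
    edges, these pairs give all pairs of darts up to reversal and a common translation. *)
Lemma intersection_number0P s t : intersection_number s t 0 <->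
  forall (c : dart (msplit s)) (d : dart (msplit t)), nestd (aisX c) (aisX d).
Proof.
have cross0 (X Y : set G) : crossing_double_cosets X Y #= `I_0 <->
    forall g, ~ crosses (translate g X) Y.
  rewrite II0 card_eq0; split=> [/eqP h0 g hg|h].
    have : crossing_double_cosets X Y (double_coset (Stab Y) g (Stab X)) by exists g.
    by rewrite h0.
  by apply/eqP/seteqP; split=> // D [g /h].
split=> [[X [Y [+ + /cross0 XY]]] c d|h].
  move=> /arises_from_orbit_half[c0 [v XE]] /arises_from_orbit_half[d0 [w YE]].
  subst X Y; have {XY} h0 g : nestd (aisX (dact g c0)) (aisX d0).
    apply: nestd_aeq (aisV_base _ v _) (aisV_base _ w _) _.
    apply: contrapT => /crossesP; rewrite /= -orbit_half_translate; exact: XY.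
  have {}h0 g h : nestd (aisX (dact g c0)) (aisX (dact h d0)).
    by have /(aisX_nestd_act h) := h0 (h^-1 * g); rewrite -dactM mulVKg.
  have [[g gc] [h hd]] := (splitting_darts (c0 : dart s) c, splitting_darts (d0 : dart t) d).
  case: gc hd => -> [] ->; rewrite ?aisX_rev.
  - exact: h0.
  - exact/nestdCr/h0.
  - exact/nestdCl/h0.
  - exact/nestdCl/nestdCr/h0.
have [[c _] [d _]] := (splitting_dart s, splitting_dart t).
exists (aisX c), (aisX d); split; first by apply/arises_from_orbit_half; exists c, base.
  by apply/arises_from_orbit_half; exists d, base.
apply/cross0 => g; rewrite /= orbit_half_translate.
by move=> /(crossesP (aisX (dact g c)) (aisX d)).1; apply; apply: h.
Qed.

(** Exact inclusions are required: they make a corner empty, whereas a merely small corner would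
    also have to be the only small one for [ai_le]. *)
Lemma sandwiched_of_sub s t (c : dart (msplit s)) (d1 d2 : dart (msplit t))
    (v : msplit s) (w : msplit t) :
  orbit_half d1 w `<=` orbit_half c v -> orbit_half c v `<=` orbit_half d2 w ->
  sandwiched s t.
Proof.
move=> h1 h2; exists (orbit_half c v), (orbit_half d1 w); split.
- by apply/arises_from_orbit_half; exists c, v.
- by apply/arises_from_orbit_half; exists d1, w.
left; exists (orbit_half d1 w), (orbit_half d2 w); split.
- by exists 1; left; rewrite translate1.
- have [g [|] ->] := splitting_darts (d1 : dart t) d2; exists g; [left|right].
    by rewrite orbit_half_translate.
  by rewrite -orbit_half_rev orbit_half_translate dact_rev.
- by left; apply/seteqP; split=> // x [/= /h1 ? ].
- by left; apply/seteqP; split=> // x [/= /h2 ? ].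
Qed.

End SplittingAis.

(** * Enclosed splittings and splittings given by edges *)

Lemma edge_orbit_act (G : groupType) (T : gtree G) (a b : T) g x y :
  edge_orbit a b (act g x) (act g y) = edge_orbit a b x y.
Proof.
have Tg := gtreeP T.
suff h k u v : edge_orbit a b u v -> edge_orbit a b (act k u) (act k v).
  by apply/idP/idP => [/(h g^-1)|/h//]; rewrite !actK.
rewrite /edge_orbit /= => /asboolP[] [l _ [<- <-]]; apply/asboolP; [left|right];
  by exists (k * l) => //=; rewrite !(actMg Tg).
Qed.

Lemma edge_orbit_adj (G : groupType) (T : gtree G) (a b : T) x y :
  adj a b -> edge_orbit a b x y -> adj x y.
Proof.
have Tg := gtreeP T; move=> ab.
rewrite /edge_orbit /= => /asboolP[] [g _ [<- <-]] /=; rewrite (act_adj Tg) //.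
by rewrite (adj_sym Tg).
Qed.

(* [U] refines both [T] and the tree of [s]; [enc_vertex c] is the image in
   [T] of the edge of [U] that lifts the edge [c]. *)
Record enclosure (G : groupType) (T : mtree G) (s : splitting G) (v : T) :=
  Enclosure {
  enc_tree : gtree G;
  enc_p : enc_tree -> T;
  enc_q : enc_tree -> msplit s;
  enc_pP : collapsing enc_p;
  enc_qP : collapsing (S := msplit s) enc_q;
  enc_vertex : dart (msplit s) -> T;
  enc_vertex_act : forall g c, enc_vertex (dact g c) = act g (enc_vertex c);
  enc_vertex_rev : forall c, enc_vertex (rev c) = enc_vertex c;
  enc_vertex_orbit : forall c, Defs.orbit v (enc_vertex c);
  enc_sides : forall e c, half e (enc_vertex c) ->
    exists b : bool, forall x, half (rev e) (enc_p x) ->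
      half (if b then c else rev c) (enc_q x)
}.

(** The lift [L c] of an edge [c] survives in the tree of [s], so it is one of the inserted edges
    and collapses to a single vertex of [T], which serves as [enc_vertex c]. *)
Lemma encloses_enclosure (G : groupType) (T : mtree G) (v : T) (s : splitting G) :
  encloses v s -> exists E : enclosure s v, True.
Proof.
move=> [U [a [b [ab [f1 iso1] [f2 iso2 orb]]]]].
set E1 := [rel x y | _] in f1 iso1.
have E1adj (x y : U) : E1 x y -> adj x y by case/andP.
have E1act g (x y : U) : E1 (act g x) (act g y) = E1 x y.
  by rewrite /E1 /= (act_adj (gtreeP U)) [in LHS]edge_orbit_act.
have E2adj (x y : U) : edge_orbit a b x y -> adj x y by apply: edge_orbit_adj.
have qP := collapsing_giso E1adj E1act iso1.
have pP := collapsing_giso E2adj (@edge_orbit_act _ _ a b) iso2.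
set q := (fun x => f1 _) in qP; set p := (fun x => f2 _) in pP.
have [L LP] := choice (collapsing_lift qP).
have Luniq c d : q (src d) = src c -> q (tgt d) = tgt c -> d = L c.
  have [sL tL] := LP c.
  move=> ds dt; apply: (collapsing_uniq qP); rewrite ?sL ?tL ?ds ?dt //.
  exact: src_neq_tgt.
have Lorb c : edge_orbit a b (src (L c)) (tgt (L c)).
  apply: contrapT => /negP norb; have [sL tL] := LP c.
  apply: (src_neq_tgt (e := c)); rewrite -sL -tL /q; congr f1.
  apply/to_collapseP; exists [:: tgt (L c)] => //=.
  by rewrite /symE /= norb dartP.
have pL c : p (src (L c)) = p (tgt (L c)).
  rewrite /p; congr f2; apply/to_collapseP; exists [:: tgt (L c)] => //=.
  by rewrite /symE /= /edge_orbit /= in Lorb *; rewrite Lorb.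
unshelve eexists (@Enclosure _ _ _ _ U p q pP qP (fun c => p (src (L c))) _ _ _ _) => //=.
- move=> g c; rewrite -(collapsing_act pP); congr p.
  have [sL tL] := LP c.
  rewrite -(Luniq (dact g c) (dact g (L c))) //=.
    by rewrite /src /= (collapsing_act qP) -/(src (L c)) sL.
  by rewrite /tgt /= (collapsing_act qP) -/(tgt (L c)) tL.
- move=> c; have [sL tL] := LP c.
  by rewrite -(Luniq (rev c) (rev (L c))) //= pL.
- by move=> c; apply: orb (Lorb c).
- move=> e c ec.
  have [e' [se' te']] := collapsing_lift pP e; have [sL tL] := LP c.
  have hE := collapsing_half pP se' te'.
  have hC := collapsing_half qP sL tL.
  have hCr := collapsing_half (e := rev (L c)) (c := rev c) qP tL sL.
  have e'c : half e' (src (L c)) by apply/hE.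
  (* [L c] lies on the source side of [e'], so the far side of [e'] is contained in the side of
     [L c] that contains [tgt e']. *)
  have [h|/half_revN h] := EM (half (L c) (tgt e')); [exists true|exists false];
    move=> x /half_revN; rewrite hE => /half_revN; rewrite ?hC ?hCr; move: (x);
    apply: sub_half => //; rewrite half_rev => -[n1 n2].
    exact: n1.
  exact: n2.
Qed.

Section EnclosureAis.
Context {G : groupType} {T : mtree G} {s : splitting G} {v : T}.
Variable E : enclosure s v.
Implicit Types (e : dart T) (c : dart (msplit s)).

Lemma enc_p_act g u : enc_p (act g u) = act g (enc_p (e0 := E) u).
Proof. exact: collapsing_act (enc_pP E) g u. Qed.

Lemma enc_q_act g u : enc_q (act g u) = act g (enc_q (e0 := E) u).
Proof. exact: collapsing_act (enc_qP E) g u. Qed.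

(** Taking the images of one vertex [u0] of the refinement as base points turns the inclusion of
    half-trees into one of sets. *)
Lemma enc_sides_ale e c :
  (forall x : enc_tree E, half (rev e) (enc_p x) -> half c (enc_q x)) ->
  ale (aisC (aisX e)) (aisX c).
Proof.
move=> ec; rewrite -aisX_rev.
have [u0 _] := tree_inhabited (gtreeP (enc_tree E)).
have sub : ale (aisV (rev e) (enc_p u0)) (aisV c (enc_q u0)).
  apply: subset_ale => g; rewrite /= /orbit_half /=.
  by rewrite -enc_p_act -enc_q_act; apply: ec.
exact: ale_trans (ale_trans (aisV_base (rev e) (@base _ T) (enc_p u0)).1 sub)
  (aisV_base _ (enc_q u0) base).1.
Qed.

Lemma enc_at c : at_vertex (enc_vertex E c) (aisX c).
Proof.
move=> e /(enc_sides (e0 := E))[[] /enc_sides_ale]; first by left.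
by rewrite aisX_rev; right.
Qed.

Lemma enc_nestd e c : nestd (aisX e) (aisX c).
Proof.
have [/enc_at|/half_revN/enc_at] := EM (half e (enc_vertex E c)).
  by case=> h; [apply: Or43|apply: Or44].
by rewrite aisX_rev aisCK; case=> h; [apply: Or41|apply: Or42].
Qed.

Lemma enc_sub e : exists c, forall x : enc_tree E,
  half (rev e) (enc_p x) -> half c (enc_q x).
Proof.
have [c _] := splitting_dart s; have [g] := mtreeP e (enc_vertex E c).
rewrite -enc_vertex_act => /(enc_sides (e0 := E))[[] h].
  by exists (dact g c).
by exists (rev (dact g c)).
Qed.

End EnclosureAis.

Arguments enc_at {G T s v} E c.

(** All edges outside the orbit of [e] are collapsed. A fixed vertex of the result would put a whole
    orbit of [T] on one side of [e], against [hull]. *)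
Lemma exists_edge_splitting (G : groupType) (T : mtree G) (e : dart T) :
  exists (s : splitting G) (q : T -> msplit s) (c : dart (msplit s)),
    (forall g x, q (act g x) = act g (q x)) /\
    forall w, half c (q w) <-> half e w.
Proof.
have Tg := gtreeP T.
pose E : rel T := [rel x y | adj x y && ~~ edge_orbit (src e) (tgt e) x y].
have Eadj (x y : T) : E x y -> adj x y by case/andP.
have Eact g (x y : T) : E (act g x) (act g y) = E x y.
  by rewrite /E /= (act_adj Tg) [in LHS]edge_orbit_act.
pose S := GTree (collapse_is_gtree Eadj Eact).
have orbE (d : dart T) : ~~ symE E (src d) (tgt d) ->
    edge_orbit (src e) (tgt e) (src d) (tgt d).
  by rewrite /symE /E /= negb_or dartP /= negbK => /andP[].
have nEe : ~~ symE E (src e) (tgt e).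
  have h : edge_orbit (src e) (tgt e) (src e) (tgt e).
    apply/asboolP; left; exists 1 => //=.
    by rewrite !(act1g Tg).
  have h' : edge_orbit (src e) (tgt e) (tgt e) (src e).
    apply/asboolP; right; exists 1 => //=.
    by rewrite !(act1g Tg).
  by rewrite /symE /E /= in h h' *; rewrite h h' !andbF.
pose q (x : T) : S := to_collapse E x.
have qact g x : q (act g x) = act g (q x) by rewrite /q -(act_to_collapse Eact).
have ce : adj (q (src e), q (tgt e)).1 (q (src e), q (tgt e)).2.
  by apply/collapse_adjP; exists e.
pose c : dart S := Dart ce.
have idP : giso (fun x : collapse E => (x : S)).
  by split=> //; exists id.
have qP : collapsing q := collapsing_giso (S := S) Eadj Eact idP.
have qc w : half c (q w) <-> half e w.
  exact: (collapsing_half (e := e) (c := c) qP erefl erefl w).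
have nofix (x : S) : exists g, act g x <> x.
  have [x0 <-] := collapsing_surj qP x; apply: contrapT => /forallNP fix_x0.
  have ex g : half e (act g x0) <-> half e x0.
    by rewrite -!qc qact; have /contrapT -> := fix_x0 g.
  have [[g /ex ex0] [h /half_revN]] := (mtreeP e x0, mtreeP (rev e) x0).
  by rewrite ex.
have one_edge : exists a b : S,
    adj a b /\ forall x y : S, adj x y -> edge_orbit a b x y.
  exists (q (src e)), (q (tgt e)); split=> // x y /collapse_adjP[d [<- <- /orbE]].
  move=> /asboolP[] [g _ /= [gs gt]]; apply/asboolP; [left|right]; exists g => //;
    rewrite -gs -gt; congr pair; exact: esym (qact g _).
by exists (Splitting nofix one_edge), q, c.
Qed.

Lemma aisX_pullback (G : groupType) (S T : mtree G) (q : T -> S)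
    (e : dart T) (c : dart S) :
  (forall g x, q (act g x) = act g (q x)) ->
  (forall w, half c (q w) <-> half e w) -> aeq (aisX e) (aisX c).
Proof.
move=> qact qc; apply: aeq_trans (aisV_base c (q (@base _ T)) base).
have -> : aisV c (q (@base _ T)) = aisX e; last exact: aeq_refl.
by apply: ais_inj; apply/seteqP; split=> g; rewrite /= /orbit_half /= -qact qc.
Qed.

(** [enc_sub] for [e] and for [rev e] gives the two bounds; base points coming from one vertex of
    the refinement keep the inclusions exact. Nestedness is inherited from [e]. *)
Lemma edge_splitting_compatible (G : groupType) (T : mtree G) (e : dart T)
    (s : splitting G) (q : T -> msplit s) (c : dart (msplit s))
    (t : splitting G) (v : T) (E : enclosure t v) :
  (forall g x, q (act g x) = act g (q x)) ->
  (forall w, half c (q w) <-> half e w) ->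
  sandwiched s t /\ intersection_number s t 0.
Proof.
move=> qact qc.
split.
  have [u0 _] := tree_inhabited (gtreeP (enc_tree E)).
  have [c1 h1] := enc_sub E e; have [c2 h2] := enc_sub E (rev e).
  rewrite revK in h2.
  apply: (@sandwiched_of_sub _ s t c (rev c1) c2 (q (enc_p u0)) (enc_q u0)).
    move=> g; rewrite /orbit_half /= -qact -enc_q_act -enc_p_act => /half_revN hg.
    by apply/qc; apply: contrapT => /half_revN/h1.
  move=> g; rewrite /orbit_half /= -qact -enc_q_act -enc_p_act => /qc.
  exact: h2.
apply/intersection_number0P => c' d.
have [g] := splitting_darts (c : dart s) c'.
have h : nestd (aisX (dact g c)) (aisX d).
  rewrite -(dactVK g d); apply: aisX_nestd_act.
  exact: nestd_aeq (aisX_pullback qact qc) (aeq_refl _) (enc_nestd E _ _).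
by case=> ->; rewrite ?aisX_rev; [|apply: nestdCl].
Qed.

(** * Isolated vertices *)

Lemma card_eq_II2 (U : Type) (A : set U) : A #= `I_2 ->
  exists a b, [/\ A a, A b, a <> b & forall x, A x -> x = a \/ x = b].
Proof.
move=> /card_set_bijP[f [fI finj fsurj]].
have [[a Aa fa] [b Ab fb]] := (fsurj 0%N isT, fsurj 1%N isT).
exists a, b; split=> // [ab|x Ax]; first by move: fb; rewrite -ab fa.
have := fI _ Ax; rewrite /= ltnS leq_eqVlt ltnS leqn0 => /orP[] /eqP fx;
  [right|left]; by apply: finj; rewrite ?in_setE // fx ?fa ?fb.
Qed.

Section IsolatedVertex.
Context {G : groupType} {T : gtree G}.
Implicit Types (v w x : T) (e d : dart T).

Let Tg := gtreeP T.

Lemma orbit_refl v : Defs.orbit v v.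
Proof. by exists 1 => //; rewrite (act1g Tg). Qed.

Lemma orbit_eq v w x : Defs.orbit v x -> Defs.orbit w x -> Defs.orbit v = Defs.orbit w.
Proof.
have h (a b c : T) : Defs.orbit a c -> Defs.orbit b c -> Defs.orbit a `<=` Defs.orbit b.
  move=> [g _ <-] [h _ hb] _ [k _ <-]; exists (k * g^-1 * h) => //.
  by rewrite (actMg Tg) hb -(actMg Tg) mulgVK.
by move=> vx wx; apply/seteqP; split; apply: h; eassumption.
Qed.

Lemma dedge_orbit_act g e : dedge_orbit (dval (dact g e)) = dedge_orbit (dval e).
Proof.
apply/seteqP; split=> _ [h _ <-].
  by exists (h * g) => //; rewrite !(actMg Tg).
exists (h * g^-1) => //=; rewrite !(actMg Tg) !actK //.
Qed.

Definition isolated_star e1 e2 := valence2 e1 e2 /\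
  forall g, act g (src e1) = src e1 -> dact g e1 = e1 /\ dact g e2 = e2.

(** An element fixing [v] and swapping its two darts would leave a single oriented edge at the image
    of [v] in the quotient. *)
Lemma isolated_vertex_star v : isolated_vertex v ->
  exists e1 e2, src e1 = v /\ isolated_star e1 e2.
Proof.
move=> [/card_eq_II2[a [b [[av aa] [bv ba] nab hab]]]].
move=> /card_eq_II2[D1 [D2 [[p1 [vp1 ap1] D1E] [p2 [vp2 ap2] D2E] nD _]]].
pose e1 := Dart aa; pose e2 := Dart ba.
have e1v : src e1 = v by [].
have e2v : src e2 = v by [].
have n12 : e1 <> e2 by move=> /(congr1 (@dval _ _)).
have star d : src d = v -> d = e1 \/ d = e2.
  move=> dv; have [|dE|dE] := hab (dval d); first by split=> //; apply: dartP.
    by left; apply: dart_inj; rewrite /src /tgt dE.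
  by right; apply: dart_inj; rewrite /src /tgt dE.
have nswap g : act g v = v -> dact g e1 = e1.
  move=> gv; have [|//|g12] := star (dact g e1); first by rewrite src_dact e1v gv.
  have e12 : dedge_orbit (dval e2) = dedge_orbit (dval e1).
    by rewrite -g12 dedge_orbit_act.
  have all1 p : Defs.orbit v p.1 -> adj p.1 p.2 ->
      dedge_orbit p = dedge_orbit (dval e1).
    move=> [h _ hv] ap; pose d := Dart ap.
    rewrite -[LHS](dedge_orbit_act h^-1 d).
    have [|-> //|->//] := star (dact h^-1 d).
    by rewrite src_dact -[src d]hv actK.
  by exfalso; apply: nD; rewrite -D1E -D2E !all1.
exists e1, e2; split=> //; split; first by
  split; [|rewrite e1v e2v|move=> d; rewrite e1v; apply: star].
move=> g; rewrite e1v => gv; have g1 := nswap g gv; split=> //.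
have [|g2|//] := star (dact g e2); first by rewrite src_dact e2v gv.
by case: n12; apply: (dact_inj (g := g)); rewrite g1 g2.
Qed.

Lemma isolated_star_act g e1 e2 : isolated_star e1 e2 ->
  isolated_star (dact g e1) (dact g e2).
Proof.
move=> [[n12 s12 h12] stab]; split; first split.
- by move=> /dact_inj.
- by rewrite !src_dact s12.
- move=> d ds; have [|dE|dE] := h12 (dact g^-1 d).
  + by rewrite src_dact ds src_dact actK.
  + by left; rewrite -dE dactVK.
  + by right; rewrite -dE dactVK.
move=> h hg; have [|h1 h2] := stab (g^-1 * h * g).
  by rewrite !(actMg Tg) [act h _]hg actK.
by split; apply: (dact_inj (g := g^-1)); rewrite dactK -!dactM ?mulgA.
Qed.

End IsolatedVertex.

(** * Regular neighborhoods with chosen enclosures *)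

Section Neighborhood.
Context {G : groupType} {J : Type} (sigma : J -> splitting G).

(** One enclosure is fixed for each [j], for isolated [j] in the orbit prescribed by (4), so that
    every edge [c] of [sigma j] labels one vertex of [T]. *)
Record nbhd (T : mtree G) := Nbhd {
  col : pred T;
  col_adj : forall d : dart T, col (tgt d) = ~~ col (src d);
  col_act : forall g x, col (act g x) = col x;
  encv : J -> T;
  enc : forall j, enclosure (sigma j) (encv j);
  encv_col : forall j, col (encv j);
  enc_cover : forall v, col v -> exists j c, enc_vertex (enc j) c = v;
  enc_star : forall j, isolated sigma j -> forall c, exists e1 e2 : dart T,
    src e1 = enc_vertex (enc j) c /\ isolated_star e1 e2;
  enc_isolated_inj : forall j k c d, isolated sigma j -> isolated sigma k ->
    enc_vertex (enc j) c = enc_vertex (enc k) d -> j = k;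
  enc_compatible : forall s : splitting G,
    (forall j, sandwiched s (sigma j) /\ intersection_number s (sigma j) 0) ->
    exists2 v, ~~ col v & exists E : enclosure s v, True
}.

(** [T] encloses every [sigma k], so its edges are nested with those of [sigma k], and nestedness
    passes to equivalent sets. *)
Lemma isolated_of_aeq (T : mtree G) (v : J -> T)
    (E : forall j, enclosure (sigma j) (v j)) j
    (c : dart (msplit (sigma j))) (e : dart T) :
  aeq (aisX c) (aisX e) -> isolated sigma j.
Proof.
move=> ce k _; apply/intersection_number0P => c' d.
have [g] := splitting_darts (c : dart (sigma j)) c'.
have h : nestd (aisX (dact g c)) (aisX d).
  rewrite -(dactVK g d); apply: aisX_nestd_act.
  exact: nestd_aeq (aeq_sym ce) (aeq_refl _) (enc_nestd (E k) _ _).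
by case=> ->; rewrite ?aisX_rev; [|apply: nestdCl].
Qed.

Lemma isolated_of_aeqC (T : mtree G) (v : J -> T)
    (E : forall j, enclosure (sigma j) (v j)) j
    (c : dart (msplit (sigma j))) (e : dart T) :
  aeq (aisX c) (aisX e) \/ aeq (aisX c) (aisC (aisX e)) -> isolated sigma j.
Proof.
by case; rewrite -?aisX_rev; apply: isolated_of_aeq.
Qed.

Lemma alg_reg_nbhd_nbhd (T : gtree G) (V0 : pred T) (h : alg_reg_nbhd sigma V0)
    (hT : hull T) :
  exists N : nbhd (MTree hT), col N = V0.
Proof.
have [f [fbij fenc]] := arn_isolated h; case: fbij => fI finj fsurj.
pose P j v := [/\ V0 v, exists E : @enclosure G (MTree hT) (sigma j) v, True &
  isolated sigma j -> isolated_vertex v /\ f j = Defs.orbit v].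
have exv j : exists v, P j v.
  have [ij|nij] := EM (isolated sigma j).
    have [v [V0v iv] fj] := fI j ij; exists v; split=> //.
    apply: encloses_enclosure; apply: (fenc j ij); rewrite -fj; exact: orbit_refl.
  have [v V0v vj] := arn_enclosed h j; exists v; split=> //.
  exact: encloses_enclosure.
have [v vP] := choice exv.
have E j : enclosure (T := MTree hT) (sigma j) (v j).
  by have [_ e _] := vP j; exact: sval (cid e).
unshelve eexists (@Nbhd (MTree hT) V0 _ _ v E _ _ _ _ _) => //.
- move=> d; have := arn_bipartite h (dartP d); rewrite -/(src d) -/(tgt d).
  by case: (V0 (src d)); case: (V0 (tgt d)).
- exact: arn_color_act h.
- by move=> j; have [] := vP j.
- move=> w V0w; have [iw|niw] := EM (isolated_vertex w).
    have [j ij jw] : exists2 j, isolated sigma j & f j = Defs.orbit w.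
      by have [|j ij fj] := fsurj (Defs.orbit w); [exists w|exists j].
    have [_ _ /(_ ij)[_ fj]] := vP j; have [c _] := splitting_dart (sigma j).
    have : Defs.orbit w (enc_vertex (E j) c).
      by rewrite -jw fj; exact: (enc_vertex_orbit (E j) c).
    move=> [g _ gw]; exists j, (dact g^-1 c).
    by rewrite enc_vertex_act -gw actK.
  have [j nij /(encloses_enclosure (T := MTree hT))[E' _]] := arn_nonisolated h V0w niw.
  have [c _] := splitting_dart (sigma j).
  have [g _ gw] := enc_vertex_orbit E' c.
  (* Condition (5) gives an enclosure at [w] that need not be the chosen one. If the chosen one put
     the same edge elsewhere, an edge of [T] between the two vertices would be equivalent to it and
     [j] would be isolated. *)
  exists j, (dact g^-1 c); apply: contrapT => neq.
  have w_at : at_vertex (T := MTree hT) w (aisX (dact g^-1 c)).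
    have := enc_at E' (dact g^-1 c).
    by rewrite enc_vertex_act -gw actK.
  have [e ev ew] := exists_dart_away neq.
  apply: nij; apply: (isolated_of_aeqC E (c := dact g^-1 c) (e := e)).
  apply: at_vertex_separated ew (enc_at (E j) _) w_at.
  by rewrite -ev; apply: half_src.
- move=> j ij c; have [_ _ /(_ ij)[iv _]] := vP j.
  have [e1 [e2 [e1v st]]] := isolated_vertex_star iv.
  have [g _ gv] := enc_vertex_orbit (E j) c.
  exists (dact g e1), (dact g e2); split; last exact: isolated_star_act.
  by rewrite -gv -e1v.
- move=> j k c d ij ik jk; apply: finj; rewrite ?in_setE //.
  have [[_ _ /(_ ij)[_ ->]] [_ _ /(_ ik)[_ ->]]] := (vP j, vP k).
  by apply: orbit_eq (enc_vertex_orbit (E j) c) _; rewrite jk; exact: (enc_vertex_orbit (E k) d).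
- move=> s /(arn_V1_encloses h)[w nw ws]; exists w => //.
  exact: encloses_enclosure.
Qed.

End Neighborhood.

Section OneNeighborhood.
Context {G : groupType} {J : Type} {sigma : J -> splitting G} {T : mtree G}.
Variable N : nbhd sigma T.
Implicit Types (e d f : dart T) (v w : T) (j k : J).

Let Tg := gtreeP T.

Notation vx j c := (enc_vertex (enc N j) c).

Lemma vx_col j c : col N (vx j c).
Proof.
have [g _ <-] := enc_vertex_orbit (enc N j) c.
by rewrite col_act encv_col.
Qed.

Lemma act_tgt_neq_src g e : act g (tgt e) <> src e.
Proof.
move=> /(congr1 (col N)); rewrite col_act col_adj.
by case: (col N (src e)).
Qed.

Lemma col_neq_rev e d : col N (src e) -> col N (src d) -> e <> rev d.
Proof. by move=> ce + ed; move: ce; rewrite ed src_rev col_adj => /negbTE ->. Qed.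

Lemma valence2_aeqC e1 e2 : valence2 e1 e2 -> aeq (aisX e2) (aisC (aisX e1)).
Proof. by move=> v12; apply: valence2_aeq v12 (fun g => @act_tgt_neq_src g e1). Qed.

Lemma nonisolated_not_valence2 j c e f : ~ isolated sigma j -> vx j c = src e ->
  ~ valence2 e f.
Proof.
move=> nij ce ef; apply: nij; apply: (isolated_of_aeqC (enc N) (c := c) (e := e)).
apply: at_vertex_valence2 ef (fun g => @act_tgt_neq_src g e) _.
by rewrite -ce; apply: enc_at.
Qed.

Lemma isolated_star_sym e f : isolated_star e f -> isolated_star f e.
Proof.
move=> [v2 st]; split; first exact: valence2_sym.
by case: v2 => _ <- _ g /st[].
Qed.

(** * Edges of an isolated splitting and the order of the darts at their vertices *)

Section Isolated.
Context {j : J} (ij : isolated sigma j).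

Lemma isolated_dart c e : vx j c = src e -> exists f, isolated_star e f.
Proof.
move=> ce; have [e1 [e2 [ce1 st]]] := enc_star N ij c.
have [[_ _ h] _] := st; have [|->|->] := h e; first by rewrite -ce -ce1.
  by exists e2.
by exists e1; apply: isolated_star_sym.
Qed.

Lemma isolated_vx_aeq c e : vx j c = src e ->
  aeq (aisX c) (aisX e) \/ aeq (aisX c) (aisC (aisX e)).
Proof.
move=> ce; have [f [ef _]] := isolated_dart ce.
apply: at_vertex_valence2 ef (fun g => @act_tgt_neq_src g e) _.
by rewrite -ce; apply: enc_at.
Qed.

(* In the common refinement the lifts of [e] and [c] are adjacent and point
   the same way. *)
Definition aligned e (c : dart (msplit (sigma j))) := vx j c = src e /\
  forall x : enc_tree (enc N j), half (rev e) (enc_p x) -> half (rev c) (enc_q x).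

Lemma aligned_half e c (x : enc_tree (enc N j)) : aligned e c ->
  half c (enc_q x) -> half e (enc_p x).
Proof.
by move=> [_ ec] cx; apply: contrapT => /half_revN/ec/half_revN.
Qed.

Lemma alignedV c e : vx j c = src e -> aligned e c \/ aligned e (rev c).
Proof.
move=> ce; have [] := enc_sides (e0 := enc N j) (e := e) (c := c).
  by rewrite ce; apply: half_src.
by case=> h; [right|left]; split; rewrite ?enc_vertex_rev ?revK.
Qed.

Lemma aligned_not_rev e c : aligned e c -> ~ aligned e (rev c).
Proof.
move=> [_ ec] [_]; rewrite revK => erc.
have [x px] := collapsing_surj (enc_pP (enc N j)) (tgt e).
have ex : half (rev e) (enc_p x) by rewrite px; apply: half_src.
by have /half_revN := ec x ex; apply; apply: erc.
Qed.

Lemma aligned_aeq e c : aligned e c -> aeq (aisX c) (aisX e).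
Proof.
move=> [ce /enc_sides_ale]; rewrite aisX_rev => h.
have [//|[_ h2]] := isolated_vx_aeq ce.
by case: (ale_contra h2 h).
Qed.

Lemma aligned_of_aeq e c : vx j c = src e -> aeq (aisX c) (aisX e) -> aligned e c.
Proof.
move=> ce ace; have [//|/aligned_aeq] := alignedV ce; rewrite aisX_rev => -[h1 h2].
by have := ale_trans ace.2 (aleCr h2); move=> /(ale_contra (ale_refl _)).
Qed.

Lemma aligned_other e f c : valence2 e f -> aligned e c -> aligned f (rev c).
Proof.
move=> ef ec; have [_ sef _] := ef.
have [|fc|//] := @alignedV c f; first by rewrite -sef; case: ec.
have [[h1 _] [h2 _] [h3 _]] := And3 (aligned_aeq ec) (aligned_aeq fc) (valence2_aeqC ef).
by case: (ale_contra h1 (ale_trans h2 h3)).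
Qed.

Lemma aligned_act g e c : aligned e c -> aligned (dact g e) (dact g c).
Proof.
move=> ec; apply: aligned_of_aeq.
  by rewrite enc_vertex_act src_dact; case: ec => ->.
exact/aisX_aeq_act/aligned_aeq.
Qed.

(** An element fixing the vertex fixes both darts there. The translates of [c'] by such elements
    therefore all separate the images of two points [x1] and [x2] lying over the two neighbours, and
    [half_shift] forbids a proper nesting among them. *)
Lemma vx_inj c b : vx j c = vx j b -> b = c \/ b = rev c.
Proof.
suff inj c' g : vx j (dact g c') = vx j c' -> dact g c' = c'.
  have [g [|] ->] := splitting_darts (c : dart (sigma j)) b.
    by move=> /esym/inj ->; left.
  by rewrite enc_vertex_rev => /esym/inj ->; right.
have [e1 [e2 [ce st]]] := enc_star N ij c'; rewrite enc_vertex_act -ce => ge.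
have [v12 stab] := st.
wlog al : c' ce ge / aligned e1 c'.
  move=> wl; have [|al|al] := @alignedV c' e1; [by []|exact: wl|].
  by apply: rev_inj; rewrite -dact_rev; apply: (wl (rev c')); rewrite ?enc_vertex_rev.
have [_ al1] := al; have [_ al2] := aligned_other v12 al.
rewrite revK in al2.
have [x1 px1] := collapsing_surj (enc_pP (enc N j)) (tgt e1).
have [x2 px2] := collapsing_surj (enc_pP (enc N j)) (tgt e2).
have q1 h : act h (src e1) = src e1 -> ~ half (dact h c') (enc_q x1).
  move=> he; apply/half_revN; rewrite -dact_rev half_actV -enc_q_act.
  apply: al1; rewrite enc_p_act px1; have [e1E _] := stab _ he.
  by rewrite -{2}e1E tgt_dact actK; apply: half_src.
have q2 h : act h (src e1) = src e1 -> half (dact h c') (enc_q x2).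
  move=> he; rewrite half_actV -enc_q_act.
  apply: al2; rewrite enc_p_act px2; have [_ e2E] := stab _ he.
  by rewrite -{2}e2E tgt_dact actK; apply: half_src.
have exp h : act h (src e1) = src e1 -> half c' `<=` half (dact h c') -> dact h c' = c'.
  move=> he sub; apply: contrapT => nhc.
  have [n] := half_shift (enc_q x2) (enc_q x1) sub nhc; apply.
  have hn : act (h ^+ n) (src e1) = src e1.
    elim: n => [|n IHn]; first by rewrite expg0 (act1g Tg).
    by rewrite expgS (actMg Tg) IHn.
  by split; [apply: q2|apply: q1].
have [] := half_nested (dact g c') c' => sub.
- have gV : act g^-1 (src e1) = src e1 by rewrite -{1}ge actK.
  have gE : dact g^-1 c' = c'.
    by apply: exp => //; rewrite -(sub_half_act g) dactVK.
  by rewrite -{1}gE dactVK.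
- by have /half_revN := sub _ (q2 g ge); have := q2 1; rewrite dact1 (act1g Tg) => /(_ erefl).
- have := sub (enc_q x1); rewrite half_revN => /(_ (q1 g ge)).
  by have := q1 1; rewrite dact1 (act1g Tg) => /(_ erefl).
- by apply: exp => //; apply/sub_half_rev.
Qed.

Lemma aligned_inj e c b : aligned e c -> aligned e b -> c = b.
Proof.
move=> ec eb; have [|->|bE] := @vx_inj c b; last 2 first.
- by [].
- by case: (aligned_not_rev ec); rewrite -bE.
by case: ec => ->; case: eb => ->.
Qed.

Lemma aligned_injl e d c : aligned e c -> aligned d c -> e = d.
Proof.
move=> ec dc; have [f [ef _]] := isolated_dart ec.1.
have [_ _ h] := ef; have [|->//|dE] := h d; first by rewrite -dc.1 ec.1.
by case: (aligned_not_rev dc); rewrite dE; apply: aligned_other ef ec.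
Qed.

Lemma aligned_sub_half e c d b : aligned e c -> aligned d b ->
  half e `<=` half d -> half c `<=` half b.
Proof.
move=> ec db sub; have [ed|ned] := EM (e = d).
  by subst d; rewrite (aligned_inj ec db).
have [f [df _]] := isolated_dart db.1.
have nsed : src e <> src d.
  by move=> sed; apply: (sub_src sub ned); rewrite -sed; apply: half_src.
have [] := enc_sides (e0 := enc N j) (e := rev e) (c := b).
  by rewrite db.1; apply/half_revN; exact: sub_src sub ned.
rewrite revK => -[] h w.
  have [x <-] := collapsing_surj (enc_qP (enc N j)) w.
  by move=> /(aligned_half ec)/h.
(* In the remaining case [src e] would lie on the source side of the other dart [f] at [src d],
   hence outside [half d]. *)
have [x px] := collapsing_surj (enc_pP (enc N j)) (src e).
have ex : half e (enc_p x) by rewrite px; apply: half_src.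
have := aligned_half (aligned_other df db) (h x ex); rewrite px.
move=> /(valence2_half df)/(_ nsed)/half_revN[]; apply: sub; exact: half_src.
Qed.

(** The two half-trees on the left differ only in [src e]. If that vertex alone were outside
    [half d], then [d] would be [rev e], which the colours forbid. *)
Lemma sub_other e d f : col N (src e) -> col N (src d) -> valence2 e f ->
  half (rev e) `<=` half d <-> half f `<=` half d.
Proof.
move=> ce cd ef; have [nef sef _] := ef.
split=> [sub w fw|]; last by move=> fd; apply: subset_trans fd; apply: same_src.
have [->|nw] := EM (w = src e); last by apply: sub; apply: valence2_half ef fw nw.
apply: contrapT => nd; apply: (col_neq_rev cd ce); apply: esym.
by apply: half_src_tgt => //; apply: sub; apply: half_src.
Qed.

Lemma aligned_col e c : aligned e c -> col N (src e).
Proof. by case=> <- _; apply: vx_col. Qed.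

Lemma aligned_sub_halfE e c d b : aligned e c -> aligned d b ->
  half e `<=` half d <-> half c `<=` half b.
Proof.
move=> ec db; split; first exact: aligned_sub_half.
have [f [ef _]] := isolated_dart ec.1.
have [h [dh _]] := isolated_dart db.1.
move=> cb; have [//|||] := half_nested e d.
- move=> sub; have [ndh sdh _] := dh.
  have := aligned_sub_half ec (aligned_other dh db) (subset_trans sub (same_src sdh ndh)).
  by move=> /(_ _ (half_src c))/half_revN[]; apply/cb/half_src.
- move=> /(sub_other (aligned_col ec) (aligned_col db) ef) sub.
  have := aligned_sub_half (aligned_other ef ec) db sub => rcb.
  case: (half_tgt (e := b)).
  by have [/cb//|/half_revN/rcb] := EM (half c (tgt b)).
- move=> /sub_half_rev sub; have bc := aligned_sub_half db ec sub.
  have bE := sub_half_anti bc cb; subst b.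
  by rewrite (aligned_injl ec db).
Qed.

(** The inequality is needed because for [c = rev b] the darts [e] and [d] are the two at one
    vertex, and this vertex lies in both half-trees. *)
Lemma aligned_sub_half_revE e c d b : aligned e c -> aligned d b ->
  half e `<=` half (rev d) <-> half c `<=` half (rev b) /\ c <> rev b.
Proof.
move=> ec db; have [h [dh _]] := isolated_dart db.1.
have hb := aligned_other dh db; have [ndh sdh _] := dh.
split=> [sub|[/(aligned_sub_halfE ec hb) sub ncb]].
  split; first by apply/(aligned_sub_halfE ec hb); apply: subset_trans sub (same_src sdh ndh).
  move=> cE; subst c.
  have := sub _ (half_src e); rewrite -ec.1 enc_vertex_rev db.1.
  by move=> /half_revN; apply; apply: half_src.
have neh : e <> h by move=> eh; apply: ncb; apply: aligned_inj ec _; rewrite eh.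
move=> w ew; apply: valence2_half dh (sub w ew) _ => wd.
by apply: (sub_src sub neh); rewrite -sdh -wd.
Qed.

Lemma aligned_rev_sub_halfE e c d b : aligned e c -> aligned d b ->
  half (rev e) `<=` half d <-> half (rev c) `<=` half b.
Proof.
move=> ec db; have [f [ef _]] := isolated_dart ec.1.
rewrite (sub_other (aligned_col ec) (aligned_col db) ef).
exact: aligned_sub_halfE (aligned_other ef ec) db.
Qed.

End Isolated.

End OneNeighborhood.

(** * Isomorphisms of trees from relations between darts *)

Section DartRelation.
Context {G : groupType} {S T : gtree G} (R : dart S -> dart T -> Prop).
Hypothesis R_total : forall e, exists e', R e e'.
Hypothesis R_onto : forall e', exists e, R e e'.
Hypothesis R_act : forall g e e', R e e' -> R (dact g e) (dact g e').
Hypothesis R_rev : forall e e', R e e' -> R (rev e) (rev e').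
Hypothesis R_src : forall e e' d d', R e e' -> R d d' ->
  src e = src d <-> src e' = src d'.

Lemma exists_dart_src (V : gtree G) (e : dart V) (x : V) : exists d, src d = x.
Proof.
have [->|xe] := EM (x = src e); first by exists e.
by have [d dx _] := exists_dart_away xe; exists d.
Qed.

(** A vertex is the class of the darts leaving it, so a relation respecting equality of sources
    descends to vertices; reversal gives adjacency. *)
Lemma giso_of_dart_rel (e0 : dart S) :
  exists f : S -> T, giso f /\ forall e e', R e e' -> f (src e) = src e'.
Proof.
have [a aP] := choice (exists_dart_src e0); have [b bP] := choice R_total.
pose f x := src (b (a x)).
have fE e e' : R e e' -> f (src e) = src e'.
  by move=> ee'; apply/(R_src (bP _) ee'); rewrite aP.
have finj x y : f x = f y -> x = y.
  by move=> /(R_src (bP (a x)) (bP (a y))); rewrite !aP.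
have fsurj y : exists x, f x = y.
  have [e' <-] := exists_dart_src (b e0) y.
  by have [e ee'] := R_onto e'; exists (src e); apply: fE.
have [f' f'P] := choice fsurj.
exists f; split=> //; split.
- by exists f' => x; [apply: finj; rewrite f'P|rewrite f'P].
- by move=> g x; rewrite -{1}(aP x) -src_dact (fE _ _ (R_act g (bP (a x)))).
move=> x y; apply/idP/idP => [fxy|xy].
  pose e' := Dart (fxy : adj (f x, f y).1 (f x, f y).2).
  have [e ee'] := R_onto e'.
  have -> : x = src e by apply: finj; rewrite (fE _ _ ee').
  have -> : y = tgt e by apply: finj; rewrite -src_rev (fE _ _ (R_rev ee')).
  exact: dartP.
pose e := Dart (xy : adj (x, y).1 (x, y).2).
have [e' ee'] := R_total e.
rewrite (fE _ _ ee' : f x = _) (fE _ _ (R_rev ee') : f y = _); exact: dartP.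
Qed.

End DartRelation.

Section OrderRelation.
Context {G : groupType}.

(* [src e = src d] says that [rev e] and [d] are consecutive in the order of
   half-trees. *)
Lemma src_eqP (T : gtree G) (e d : dart T) : src e = src d <-> e = d \/
  [/\ rev e <> d, half (rev e) `<=` half d & forall h,
    half (rev e) `<=` half h -> half h `<=` half d -> h = rev e \/ h = d].
Proof.
split=> [sed|[->//|[ned sub between]]].
  have [->|ned] := EM (e = d); [by left|right]; split; last 2 first.
  - exact: same_src.
  - move=> h rh hd; apply: contrapT => /not_orP[nhr nhd].
    by apply: (sub_src hd nhd); rewrite -sed; apply: (sub_tgt rh); apply: nesym.
  by move=> dE; apply: (src_neq_tgt (e := e)); rewrite sed -dE.
apply: contrapT => nsed.
(* The first dart from [src d] towards [src e], once reversed, lies strictly between [rev e] and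
   [d]. *)
have [g gd ge] := exists_dart_away (nesym nsed).
have ngd : g <> d.
  by move=> gE; apply: ge; rewrite gE -tgt_rev; apply: sub_tgt.
have sub1 : half (rev e) `<=` half (rev g).
  apply/sub_half_rev; rewrite !revK; apply: sub_half; first by case.
  by rewrite gd; apply: contrapT => /half_revN; apply: sub_src.
have [/rev_inj gE|gE] := between (rev g) sub1 (same_src gd ngd).
  by apply: nsed; rewrite -gE.
by apply: (src_neq_tgt (e := g)); rewrite gd -gE.
Qed.

Lemma src_eq_of_order (S T : gtree G) (R : dart S -> dart T -> Prop) :
  (forall e', exists e, R e e') ->
  (forall e e', R e e' -> R (rev e) (rev e')) ->
  (forall e e' d d', R e e' -> R d d' -> half e `<=` half d <-> half e' `<=` half d') ->
  forall e e' d d', R e e' -> R d d' -> src e = src d -> src e' = src d'.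
Proof.
move=> onto Rrev ord e e' d d' ee' dd' /src_eqP sed; apply/src_eqP.
have eqR a a' b b' : R a a' -> R b b' -> a = b <-> a' = b'.
  move=> aa' bb'; split=> E; subst.
    by apply: sub_half_anti; [apply/(ord _ _ _ _ aa' bb')|apply/(ord _ _ _ _ bb' aa')].
  by apply: sub_half_anti; [apply/(ord _ _ _ _ aa' bb')|apply/(ord _ _ _ _ bb' aa')].
have ree' := Rrev _ _ ee'.
case: sed => [/(eqR _ _ _ _ ee' dd')|[ned sub between]]; [by left|right].
split; first by move=> /(eqR _ _ _ _ ree' dd').
  exact/(ord _ _ _ _ ree' dd').
move=> h' ; have [h hh'] := onto h'.
move=> /(ord _ _ _ _ ree' hh') h1 /(ord _ _ _ _ hh' dd') /(between _ h1).
by case=> [/(eqR _ _ _ _ hh' ree')|/(eqR _ _ _ _ hh' dd')]; [left|right].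
Qed.

Lemma giso_of_order (S T : gtree G) (R : dart S -> dart T -> Prop) (e0 : dart S) :
  (forall e, exists e', R e e') -> (forall e', exists e, R e e') ->
  (forall g e e', R e e' -> R (dact g e) (dact g e')) ->
  (forall e e', R e e' -> R (rev e) (rev e')) ->
  (forall e e' d d', R e e' -> R d d' -> half e `<=` half d <-> half e' `<=` half d') ->
  gisomorphic S T.
Proof.
move=> tot onto Ract Rrev ord.
have [|f [fiso _]] := giso_of_dart_rel tot onto Ract Rrev _ e0; last by exists f.
move=> e e' d d' ee' dd'; split; first exact: src_eq_of_order ee' dd'.
apply: (@src_eq_of_order _ _ (fun a b => R b a)) ee' dd' => // [a a' aa'|a a' b b' aa' bb'].
  exact: Rrev.
by rewrite (ord _ _ _ _ aa' bb').
Qed.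

End OrderRelation.

(** * Two consecutive darts [e] and [rev f] at a vertex of valence two *)

Section Consecutive.
Context {G : groupType} {T : gtree G} (e f : dart T).
Hypothesis tef : tgt e = tgt f.
Hypothesis v2 : valence2 (rev e) (rev f).
Hypothesis no_swap : forall g, dact g e <> f.

(** Since the half-trees differ by one vertex, [e] and [rev f] compare alike with their own
    translates as long as nothing maps [e] to [f]. *)
Let halfE w : half (rev f) w <-> half e w \/ w = tgt e.
Proof.
split=> [fw|[|->]]; last 2 first.
- by apply: same_tgt => // ef; case: v2 => + _ _; apply; rewrite ef.
- by rewrite tef; apply: half_src.
have [|nw] := EM (w = tgt e); [by right|left].
by have := valence2_half v2 fw nw; rewrite revK.
Qed.

Let halfgE g w : half (dact g (rev f)) w <-> half (dact g e) w \/ w = act g (tgt e).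
Proof.
rewrite !half_actV halfE; split=> -[]; try by left.
  by move=> /(congr1 (act g)); rewrite actVK; right.
by move=> ->; rewrite actK; right.
Qed.

Let fixed g : tgt e = act g (tgt e) -> dact g e = e.
Proof.
move=> ge; have [_ _ /(_ (dact g (rev e)))[]] := v2.
- by rewrite src_dact src_rev -ge.
- by rewrite dact_rev => /rev_inj.
- by rewrite dact_rev => /rev_inj /no_swap.
Qed.

Lemma consecutive_sub g :
  half e `<=` half (dact g e) <-> half (rev f) `<=` half (dact g (rev f)).
Proof.
split=> [sub w /halfE[/sub|->]|sub w ew]; rewrite ?halfgE; first by left.
  have [|nm] := EM (half (dact g e) (tgt e)); [by left|right].
  by rewrite {1}(half_src_tgt (sub _ (half_src e)) nm).
have /sub/halfgE[//|wE] : half (rev f) w by apply/halfE; left.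
have wf : half (rev f) w by apply/halfE; left.
have /(half_src_tgt _)E : ~ half (rev f) (tgt (dact g (rev f))).
  by move=> /sub/half_tgt.
have gf : dact g (rev f) = rev f.
  by apply: E; rewrite src_dact src_rev -tef -wE.
by case: (half_tgt (e := e)); rewrite tef -(src_rev f) -gf src_dact src_rev -tef -wE.
Qed.

Lemma consecutive_sub_rev g : half e `<=` half (rev (dact g e)) <->
  half (rev f) `<=` half (rev (dact g (rev f))).
Proof.
split=> [sub w|sub].
  have sub' u : half (dact g e) u -> ~ half e u.
    by move=> gu /sub/half_revN.
  move=> /halfE[ew|->]; apply/half_revN => /halfgE.
    case=> [/sub'//|wE]; apply: (@dact_neq_rev _ _ g e); rewrite -[dact g e]revK.
    congr rev; apply: half_src_tgt; first by rewrite src_rev tgt_dact -wE.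
    by apply: sub'; apply: half_src.
  case=> [gm|/fixed gE].
    apply: (@dact_neq_rev _ _ g e); apply: esym; apply: half_src_tgt => //.
    by move=> /sub'; apply; apply: half_src.
  by apply: (sub' (src e)); rewrite ?gE; apply: half_src.
apply: (@subset_trans _ (half (rev f))); first by move=> w ew; apply/halfE; left.
apply: subset_trans sub _; apply/sub_half_rev; rewrite !revK => w gw.
by apply/halfgE; left.
Qed.

Lemma consecutive_rev_sub g : half (rev e) `<=` half (dact g e) <->
  half f `<=` half (dact g (rev f)).
Proof.
split=> [sub w fw|sub w /half_revN ew].
  apply/halfgE; left; apply/sub/half_revN => ew.
  have /half_revN : half (rev f) w by apply/halfE; left.
  exact.
have nrev : dact g (rev f) <> f by rewrite -{2}(revK f); apply: dact_neq_rev.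
have [->|nwm] := EM (w = tgt e).
  apply: contrapT => gm.
  have [/fixed gE|ngm] := EM (tgt e = act g (tgt e)).
    have fE : half (dact g (rev f)) = half (rev f).
      by apply/seteqP; split=> u; rewrite halfE halfgE gE -tgt_dact gE.
    have := sub _ (half_src f); rewrite fE => /half_revN; apply; exact: half_src.
  apply: nrev; apply: esym; apply: half_src_tgt; first by apply: sub; apply: half_src.
  by rewrite -tef => /halfgE[].
have fw : half f w.
  by apply: contrapT => /half_revN/halfE[].
have [//|wE] := (halfgE g w).1 (sub w fw).
case: nrev; apply: half_src_tgt; first by rewrite src_dact src_rev -tef -wE.
by move=> /sub/half_tgt.
Qed.

End Consecutive.

(** * Neighbouring isolated vertices with equivalent darts *)

Section AdjacentIsolated.
Context {G : groupType} {J : Type} {sigma : J -> splitting G} {T : mtree G}.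
Context {N : nbhd sigma T} {j k : J}.
Hypotheses (hiso : pairwise_nonisomorphic sigma).
Hypotheses (ij : isolated sigma j) (ik : isolated sigma k).
Variables (e f : dart T).
Variables (c : dart (msplit (sigma j))) (d : dart (msplit (sigma k))).
Hypotheses (ec : aligned N e c) (fd : aligned N f d).

(** The pairing sends [c] to [rev d], because [e] and [f] point towards each other. *)
Let cs (s : bool) := if s then c else rev c.
Let ds (s : bool) := if s then rev d else d.

(** Alignment carries both orders to [T], where the comparisons for consecutive darts apply. The
    inequality in [aligned_sub_half_revE] holds since no edge is inverted. *)
Lemma aligned_order (x : G) s t :
  tgt e = tgt f -> valence2 (rev e) (rev f) -> (forall g, dact g e <> f) ->
  half (cs s) `<=` half (dact x (cs t)) <-> half (ds s) `<=` half (dact x (ds t)).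
Proof.
move=> tef v2 nsw.
have ecx y := aligned_act ij y ec; have fdx y := aligned_act ik y fd.
have TT y : half c `<=` half (dact y c) <-> half (rev d) `<=` half (dact y (rev d)).
  rewrite -(aligned_sub_halfE ij ec (ecx y)) (consecutive_sub tef v2) !dact_rev.
  by rewrite -!sub_half_rev (aligned_sub_halfE ik (fdx y) fd).
have TF y : half c `<=` half (rev (dact y c)) <-> half (rev d) `<=` half (dact y d).
  rewrite -(aligned_rev_sub_halfE ik fd (fdx y)).
  rewrite -(revK (dact y f)) -dact_rev -(consecutive_sub_rev tef v2 nsw).
  rewrite (aligned_sub_half_revE ij ec (ecx y)); split=> [h|[]//].
  by split=> // cE; apply: (dact_neq_rev (g := y) (e := c)); rewrite {2}cE revK.
have FT y : half (rev c) `<=` half (dact y c) <-> half d `<=` half (rev (dact y d)).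
  rewrite -(aligned_rev_sub_halfE ij ec (ecx y)) (consecutive_rev_sub tef v2 nsw).
  rewrite dact_rev (aligned_sub_half_revE ik fd (fdx y)); split=> [[]//|h].
  by split=> // dE; apply: (dact_neq_rev (g := y) (e := d)); rewrite {2}dE revK.
case: s t => -[]; rewrite /cs /ds.
- exact: TT.
- by rewrite dact_rev.
- by rewrite dact_rev.
(* Both signs reversed: complementation reverses the inclusion, and translating by [x^-1] brings
   back the case [TT]. *)
- have V (S : gtree G) (a : dart S) :
      half (dact x a) `<=` half a <-> half a `<=` half (dact x^-1 a).
    by rewrite -{1}(dactVK x a) -{2}(dactVK x a) sub_half_act dactVK.
  rewrite dact_rev -sub_half_rev V TT dact_rev -sub_half_rev.
  by rewrite -(sub_half_act x) dactVK.
Qed.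

(* Unless some [g] takes [e] to [f], the consecutive darts [e] and [rev f] are
   ordered in the same way relative to their translates, and so are the edges
   of [sigma j] and [sigma k] aligned with them. *)
Lemma adjacent_isolated : e <> f -> tgt e = tgt f ->
  aeq (aisX e) (aisC (aisX f)) -> j = k.
Proof.
move=> nef tef aef.
have [[g gE]|/forallNP nsw] := EM (exists g, dact g e = f).
  apply: (@enc_isolated_inj _ _ _ _ N j k (dact g c) d) => //.
  by rewrite fd.1 -gE enc_vertex_act ec.1.
have v2 : valence2 (rev e) (rev f).
  apply: valence2_sym; have [|||h v2 _] := @aeq_valence2 _ _ e (rev f).
  - by rewrite aisX_rev.
  - exact: same_tgt.
  - exact: (col_neq_rev (aligned_col ec) (aligned_col fd)).
  have [_ _ /(_ (rev e))[]] := v2; first by rewrite !src_rev.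
    by move=> /rev_inj.
  by move=> ->.
apply: contrapT => njk; apply: (hiso njk).
pose R (a : dart (sigma j)) (a' : dart (sigma k)) :=
  exists g s, a = dact g (cs s) /\ a' = dact g (ds s).
have csN s : rev (cs s) = cs (~~ s) by case: s; rewrite //= revK.
have dsN s : rev (ds s) = ds (~~ s) by case: s; rewrite //= revK.
apply: (@giso_of_order _ _ _ R c).
- move=> a; have [g [] aE] := splitting_darts (c : dart (sigma j)) a.
    by exists (dact g (ds true)), g, true.
  by exists (dact g (ds false)), g, false; rewrite aE /cs dact_rev.
- move=> a; have [g [] aE] := splitting_darts (d : dart (sigma k)) a.
    by exists (dact g (cs false)), g, false.
  by exists (dact g (cs true)), g, true; rewrite aE /ds dact_rev.
- by move=> g a a' [h [s [-> ->]]]; exists (g * h), s; rewrite !dactM.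
- move=> a a' [h [s [-> ->]]]; exists h, (~~ s).
  by rewrite -csN -dsN !dact_rev.
move=> a a' b b' [g [s [-> ->]]] [h [t [-> ->]]].
rewrite -(mulVKg g h) !dactM !sub_half_act -!dactM; exact: aligned_order.
Qed.

End AdjacentIsolated.

(** * Matching the darts that leave [V_0]-vertices *)

Section TwoNeighborhoods.
Context {G : groupType} {J : Type} {sigma : J -> splitting G}.

Section Match.
Context {T1 T2 : mtree G} (N1 : nbhd sigma T1) (N2 : nbhd sigma T2).

Notation vx1 j c := (enc_vertex (enc N1 j) c).
Notation vx2 j c := (enc_vertex (enc N2 j) c).

(* The splitting given by an edge of [T1] crosses none of the [sigma j], so
   [T2] encloses it at a vertex of the second color. *)
Lemma edge_at_vertex (e : dart T1) :
  exists2 w : T2, ~~ col N2 w & at_vertex w (aisX e).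
Proof.
have [s [q [c [qact qc]]]] := exists_edge_splitting e.
have [v nv [E _]] := enc_compatible N2 (fun j =>
  edge_splitting_compatible (enc N1 j) qact qc).
exists (enc_vertex E c); last first.
  exact: at_vertex_aeq (aeq_sym (aisX_pullback qact qc)) (enc_at E c).
by have [g _ <-] := enc_vertex_orbit E c; rewrite col_act.
Qed.

(** The common label [c] fixes the sources; among the darts at one source, equivalence of sets
    leaves only one. *)
Definition matched (e : dart T1) (e' : dart T2) := exists j c,
  [/\ vx1 j c = src e, vx2 j c = src e' & aeq (aisX e) (aisX e')].

Definition matched_at j (e : dart T1) (e' : dart T2) := isolated sigma j /\
  exists2 c, aligned (j := j) N1 e c & aligned N2 e' c.

Lemma matched_col1 e e' : matched e e' -> col N1 (src e).
Proof. by case=> j [c [<- _ _]]; apply: vx_col. Qed.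

Lemma matched_col2 e e' : matched e e' -> col N2 (src e').
Proof. by case=> j [c [_ <- _]]; apply: vx_col. Qed.

Lemma matched_act g e e' : matched e e' -> matched (dact g e) (dact g e').
Proof.
move=> [j [c [ce ce' ee']]]; exists j, (dact g c).
by rewrite !enc_vertex_act ce ce' !src_dact; split=> //; apply: aisX_aeq_act.
Qed.

Lemma matched_isolated e e' f' : matched e e' -> valence2 e' f' ->
  exists j, matched_at j e e'.
Proof.
move=> [j [c [ce ce' ee']]] v2; exists j.
have ij : isolated sigma j.
  by apply: contrapT => nij; apply: (nonisolated_not_valence2 nij ce' v2).
split=> //.
wlog al : c ce ce' / aligned N1 e c.
  move=> wl; have [al|al] := alignedV ce; first exact: wl ce ce' al.
  by apply: wl al; rewrite enc_vertex_rev.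
exists c => //; apply: aligned_of_aeq => //.
exact: aeq_trans (aligned_aeq ij al) ee'.
Qed.

Lemma matched_at_sub j e e' d d' : matched_at j e e' -> matched_at j d d' ->
  half e `<=` half d <-> half e' `<=` half d'.
Proof.
move=> [ij [c ec ec']] [_ [b db db']].
by rewrite (aligned_sub_halfE ij ec db) (aligned_sub_halfE ij ec' db').
Qed.

Lemma matched_at_sub_rev j e e' d d' : matched_at j e e' -> matched_at j d d' ->
  half e `<=` half (rev d) <-> half e' `<=` half (rev d').
Proof.
move=> [ij [c ec ec']] [_ [b db db']].
by rewrite (aligned_sub_half_revE ij ec db) (aligned_sub_half_revE ij ec' db').
Qed.

End Match.

Lemma matched_sym (T1 T2 : mtree G) (N1 : nbhd sigma T1) (N2 : nbhd sigma T2) e e' :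
  matched N1 N2 e e' -> matched N2 N1 e' e.
Proof. by case=> j [c [? ? /aeq_sym ?]]; exists j, c. Qed.

Lemma matched_at_sym (T1 T2 : mtree G) (N1 : nbhd sigma T1) (N2 : nbhd sigma T2) j e e' :
  matched_at N1 N2 j e e' -> matched_at N2 N1 j e' e.
Proof. by case=> ij [c ? ?]; split=> //; exists c. Qed.

Section MatchVertices.
Context {T1 T2 : mtree G} (N1 : nbhd sigma T1) (N2 : nbhd sigma T2).

Notation vx1 j c := (enc_vertex (enc N1 j) c).
Notation vx2 j c := (enc_vertex (enc N2 j) c).

Lemma nonisolated_one_side (T : mtree G) (N : nbhd sigma T) j
    (c : dart (msplit (sigma j))) (e : dart T) : ~ isolated sigma j ->
  ale (aisX e) (aisX c) \/ ale (aisX e) (aisC (aisX c)) ->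
  ale (aisC (aisX e)) (aisX c) \/ ale (aisC (aisX e)) (aisC (aisX c)) -> False.
Proof.
move=> nij h1 h2; apply: nij; apply: (isolated_of_aeqC (enc N) (c := c) (e := e)).
exact: aeq_of_both_sides.
Qed.

Lemma ale_trans_or (A B C : ais G) : ale A B -> ale B C \/ ale B (aisC C) ->
  ale A C \/ ale A (aisC C).
Proof. by move=> AB [BC|BC]; [left|right]; apply: ale_trans AB BC. Qed.

(* Otherwise an edge [e'] of [T2] separates the two images; it lives at a
   vertex of [T1] behind some edge [e] at the common vertex, and comparing
   [e] and [e'] makes [c] or [d] equivalent to an edge. *)
Lemma vx_match_nonisolated j k c d : ~ isolated sigma j -> ~ isolated sigma k ->
  vx1 j c = vx1 k d -> vx2 j c = vx2 k d.
Proof.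
move=> nij nik cd; apply: contrapT => neq.
have [e' e'c e'd] := exists_dart_away neq.
have {}e'c : half e' (vx2 j c) by rewrite -e'c; apply: half_src.
have [w nw w_at] := edge_at_vertex N2 N1 e'.
have vw : vx1 j c <> w by move=> vw; move: nw; rewrite -vw vx_col.
have [e ev ew] := exists_dart_away vw.
have ec : half e (vx1 j c) by rewrite -ev; apply: half_src.
have /half_revN/w_at := ew; rewrite aisX_rev aisCK.
have c_e := enc_at _ c e ec.
have d_e : ale (aisC (aisX e)) (aisX d) \/ ale (aisC (aisX e)) (aisC (aisX d)).
  by apply: (enc_at (enc N1 k)); rewrite -cd.
have c_e' := enc_at _ c e' e'c.
have /half_revN/enc_at := e'd; rewrite aisX_rev aisCK => d_e'.
case=> [h|h].
  exact: (nonisolated_one_side N1 nik (ale_trans_or h d_e') d_e).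
exact: (nonisolated_one_side N1 nij (ale_trans_or h c_e') c_e).
Qed.

(** An isolated label forces valence two, which a non-isolated one excludes, so the two kinds never
    share a vertex. *)
Lemma vx_match j k c d : vx1 j c = vx1 k d -> vx2 j c = vx2 k d.
Proof.
have mixed l m (a : dart (msplit (sigma l))) (b : dart (msplit (sigma m))) :
    isolated sigma l -> ~ isolated sigma m -> vx1 l a <> vx1 m b.
  move=> il nim ab; have [e1 [e2 [ea [v2 _]]]] := enc_star N1 il a.
  by apply: (nonisolated_not_valence2 (N := N1) (c := b) nim _ v2); rewrite ea.
have [ij|nij] := EM (isolated sigma j); have [ik|nik] := EM (isolated sigma k).
- move=> cd; have jk := enc_isolated_inj ij ik cd; subst k.
  by have [->|->] := vx_inj ij cd; rewrite ?enc_vertex_rev.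
- by move=> /(mixed _ _ _ _ ij nik).
- by move=> /esym/(mixed _ _ _ _ ik nij).
- exact: vx_match_nonisolated.
Qed.

Lemma matched_src e e' d d' : matched N1 N2 e e' -> matched N1 N2 d d' ->
  src e = src d -> src e' = src d'.
Proof.
by move=> [j [c [ce <- _]]] [k [b [bd <- _]]]; rewrite -ce -bd; apply: vx_match.
Qed.

Lemma matched_fun e e' d' : matched N1 N2 e e' -> matched N1 N2 e d' -> e' = d'.
Proof.
move=> ee' ed'; apply: aisX_same_src; first exact: matched_src ee' ed' _.
have [_ [_ [_ _ [_ h1]]]] := ee'; have [_ [_ [_ _ [h2 _]]]] := ed'.
exact: ale_trans h1 h2.
Qed.

(** In the non-isolated case one passes to the other tree and back: [e] points to a dart [e'] at the
    matching vertex, and [e'] to a dart [d] at [src e]. Any orientation other than [d] below [e']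
    below [e] would make [c] equivalent to an edge, and [d] below [e] at one source gives
    [d = e]. *)
Lemma matched_total e : col N1 (src e) -> exists e', matched N1 N2 e e'.
Proof.
move=> /enc_cover[j [c ce]].
have [ij|nij] := EM (isolated sigma j).
  wlog al : c ce / aligned N1 e c.
    move=> wl; have [al|al] := alignedV ce; first exact: wl ce al.
    by apply: wl al; rewrite enc_vertex_rev.
  have [e1 [e2 [ce1 [v2 _]]]] := enc_star N2 ij c.
  have [e' al'] : exists e', aligned N2 e' c.
    have [al1|al1] := alignedV (esym ce1); first by exists e1.
    by exists e2; rewrite -(revK c); apply: aligned_other v2 al1.
  exists e', j, c; split=> //; first by case: al'.
  exact: aeq_trans (aeq_sym (aligned_aeq ij al)) (aligned_aeq ij al').
have [w' nw' w'_at] := edge_at_vertex N1 N2 e.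
have vw' : vx2 j c <> w' by move=> vw; move: nw'; rewrite -vw vx_col.
have [e' e'v e'w] := exists_dart_away vw'.
have [w nw w_at] := edge_at_vertex N2 N1 e'.
have vw : vx1 j c <> w by move=> vw; move: nw; rewrite -vw vx_col.
have [d dv dw] := exists_dart_away vw.
have c_e : ale (aisC (aisX e)) (aisX c) \/ ale (aisC (aisX e)) (aisC (aisX c)).
  by apply: (enc_at (enc N1 j)); rewrite ce; apply: half_src.
have c_d : ale (aisC (aisX d)) (aisX c) \/ ale (aisC (aisX d)) (aisC (aisX c)).
  by apply: (enc_at (enc N1 j)); rewrite -dv; apply: half_src.
have c_e' : ale (aisC (aisX e')) (aisX c) \/ ale (aisC (aisX e')) (aisC (aisX c)).
  by apply: (enc_at (enc N2 j)); rewrite -e'v; apply: half_src.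
exists e', j, c; split=> //.
have /half_revN/w'_at := e'w; rewrite aisX_rev aisCK => -[e'e|e'e]; last first.
  by case: (nonisolated_one_side N2 nij (ale_trans_or e'e c_e) c_e').
have /half_revN/w_at := dw; rewrite aisX_rev aisCK => -[de'|de']; last first.
  by case: (nonisolated_one_side N2 nij (ale_trans_or (aleCr de') c_d) c_e').
have dE : d = e by apply: aisX_same_src (ale_trans de' e'e); rewrite dv.
by split=> //; rewrite -{1}dE.
Qed.

End MatchVertices.

End TwoNeighborhoods.

(** * Matched darts with a common target *)

Section MatchTargets.
Context {G : groupType} {J : Type} {sigma : J -> splitting G}.
Hypothesis hiso : pairwise_nonisomorphic sigma.

Lemma adjacent_matched_at (T1 T2 : mtree G) (N1 : nbhd sigma T1)
    (N2 : nbhd sigma T2) j k e e' f f' :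
  matched_at N1 N2 j e e' -> matched_at N1 N2 k f f' ->
  e <> f -> tgt e = tgt f -> aeq (aisX e) (aisC (aisX f)) -> j = k.
Proof.
by move=> [ij [c ec _]] [ik [d fd _]]; exact: (adjacent_isolated hiso ij ik ec fd).
Qed.

(** The only nesting not excluded by the sets has [e'] and [rev f'] equivalent. Then both sources
    have valence two, the adjacent darts [e] and [f] come from the same [j], and for one [j] the
    order is preserved. *)
Lemma matched_disjoint (T1 T2 : mtree G) (N1 : nbhd sigma T1)
    (N2 : nbhd sigma T2) e e' f f' :
  matched N1 N2 e e' -> matched N1 N2 f f' -> e <> f -> tgt e = tgt f ->
  half e' `<=` half (rev f').
Proof.
move=> ee' ff' nef tef; have ef := same_tgt tef nef.
have [j [c [_ _ [_ ae]]]] := ee'; have [k [d [_ _ af]]] := ff'.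
have := aisX_sub ef; rewrite aisX_rev => Xef.
have Xef' : ale (aisX e') (aisC (aisX f')).
  exact: ale_trans (ale_trans ae Xef) (aeqC af).1.
have [/aisX_sub h|//|sub|/sub_half_rev/aisX_sub h] := half_nested e' f'.
- by case: (ale_contra h Xef').
- have fe' : half (rev f') `<=` half e' by apply/sub_half_rev; rewrite revK.
  have afe' : aeq (aisX (rev f')) (aisX e').
    by split; [apply: aisX_sub|rewrite aisX_rev].
  have afe'C : aeq (aisX (rev e')) (aisX f').
    by have := aeqC (aeq_sym afe'); rewrite -!aisX_rev revK.
  have nef' : e' <> rev f' := col_neq_rev (matched_col2 ee') (matched_col2 ff').
  have [h v2e _] := aeq_valence2 afe' fe' (nesym nef').
  have [|h' v2f _] := aeq_valence2 afe'C sub.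
    by move=> E; apply: nef'; rewrite -E revK.
  have [l el] := matched_isolated ee' v2e; have [m fm] := matched_isolated ff' v2f.
  have lm : l = m.
    apply: (adjacent_matched_at el fm nef tef); split=> //.
    apply: ale_trans (aeqC af).1 (ale_trans _ ae).
    by rewrite -aisX_rev; case: afe'.
  by subst m; apply/(matched_at_sub_rev el fm).
- by case: (ale_contra (ale_refl _) (ale_trans h Xef')).
Qed.

(** The witness is the last dart on the path from [tgt f] to [tgt e]. *)
Lemma exists_dart_toward (T : mtree G) (N : nbhd sigma T) (e f : dart T) :
  col N (src e) -> col N (src f) -> half e `<=` half (rev f) -> tgt e <> tgt f ->
  exists h, [/\ col N (src h), tgt h = tgt e, h <> e & half f `<=` half h].
Proof.
move=> ce cf ef /[dup] nt /exists_dart_away[k ke kf].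
have hf : half (rev k) (tgt f) by apply/half_revN.
have nef := col_neq_rev ce cf.
exists (rev k).
have ch : col N (src (rev k)).
  by rewrite src_rev col_adj ke col_adj negbK.
split=> //; rewrite ?tgt_rev //.
- move=> kE; apply: nef; apply/esym/half_src_tgt; first by rewrite -kE.
  by move=> /ef/half_revN; apply; apply: half_src.
- apply: sub_half; first by rewrite tgt_rev ke => -[_]; apply/half_revN/(sub_tgt ef).
  apply: contrapT => nhf; apply: (col_neq_rev ch cf); apply/esym.
  exact: half_src_tgt.
Qed.

(* The dart [h] matched with the one between [e'] and [f'] at the target of
   [e'] can only lie on the wrong side of [f]. *)
Lemma matched_between (T1 T2 : mtree G) (N1 : nbhd sigma T1)
    (N2 : nbhd sigma T2) e e' f f' h h' :
  matched N1 N2 e e' -> matched N1 N2 f f' -> matched N1 N2 h h' ->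
  tgt e = tgt f -> tgt e' <> tgt f' -> tgt h' = tgt e' -> h' <> e' ->
  half f' `<=` half h' ->
  half h `<=` half f /\ aeq (aisX f) (aisX h).
Proof.
move=> ee' ff' hh' tef te'f' th'e' nhe' fh'.
have Xfh : ale (aisX f) (aisX h).
  have [_ [_ [_ _ [h1 _]]]] := ff'; have [_ [_ [_ _ [_ h2]]]] := hh'.
  exact: ale_trans h1 (ale_trans (aisX_sub fh') h2).
have [sub|sub] := aisX_le Xfh; last by split=> //; split=> //; apply: aisX_sub.
have eh : half e `<=` half (rev h).
  by apply: matched_disjoint (matched_sym ee') (matched_sym hh') (nesym nhe') (esym th'e').
exfalso; have fh := sub _ (half_src f).
have /half_revN he := eh _ (half_src e).
have [hm|hm] := EM (half h (tgt e)).
  apply: (col_neq_rev (matched_col1 hh') (matched_col1 ee')).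
  by apply/esym/half_src_tgt.
have fE : f = h by apply: half_src_tgt => //; rewrite -tef.
by subst h; apply: te'f'; rewrite -th'e' (matched_fun ff' hh').
Qed.

(** If the targets differed, there would be darts [h'] and [k'] between [e'] and [f'], whose
    partners lie behind [f] and [e]. All sets involved then agree up to complement, so the
    splittings are isolated, and adjacency in either tree identifies their indices. The order
    preserved for a single index now contradicts the positions of [h] and [h']. *)
Lemma matched_tgt (T1 T2 : mtree G) (N1 : nbhd sigma T1) (N2 : nbhd sigma T2)
    e e' f f' :
  matched N1 N2 e e' -> matched N1 N2 f f' -> tgt e = tgt f -> tgt e' = tgt f'.
Proof.
move=> ee' ff' tef; have [E|nef] := EM (e = f).
  by subst f; rewrite (matched_fun ee' ff').
apply: contrapT => nt'.
have sub := matched_disjoint ee' ff' nef tef.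
have sub' : half f' `<=` half (rev e') by apply/sub_half_rev; rewrite revK.
have [ce' cf'] := (matched_col2 ee', matched_col2 ff').
have [h' [ch' th' nhe' fh']] := exists_dart_toward ce' cf' sub nt'.
have [k' [ck' tk' nkf' ek']] := exists_dart_toward cf' ce' sub' (nesym nt').
have [h /matched_sym hh'] := matched_total N1 ch'.
have [k /matched_sym kk'] := matched_total N1 ck'.
have [hf afh] := matched_between ee' ff' hh' tef nt' th' nhe' fh'.
have [ke aek] := matched_between ff' ee' kk' (esym tef) (nesym nt') tk' nkf' ek'.
have aeqM a a' : matched N1 N2 a a' -> aeq (aisX a) (aisX a') by case=> ? [? [_ _ ?]].
have nfh' : f' <> h' by move=> E; apply: nt'; rewrite E th'.
have nek' : e' <> k' by move=> E; apply: nt'; rewrite E tk'.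
have hk' : ale (aisC (aisX h')) (aisX k').
  have [sb|sb|sb|/sub_half_rev sb] := half_nested h' k'.
  - have /half_revN[] := same_tgt (esym tk') (nesym nkf') (half_src f').
    exact/sb/fh'/half_src.
  - case: (col_neq_rev ch' ck'); apply/esym/half_src_tgt.
      by rewrite src_rev tk'; apply: sub_tgt fh' nfh'.
    by move=> /sb/half_revN; apply; apply: half_src.
  - by rewrite -aisX_rev; apply: aisX_sub.
  - have /half_revN[] := same_tgt (esym th') (nesym nhe') (half_src e').
    exact/sb/ek'/half_src.
have aef : aeq (aisX e) (aisC (aisX f)).
  split; first by rewrite -aisX_rev; apply/aisX_sub/same_tgt.
  apply: ale_trans (aeqC afh).1 (ale_trans (aeqC (aeqM _ _ hh')).1 _).
  exact: ale_trans hk' (ale_trans (aeqM _ _ kk').2 aek.2).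
have nhf : h <> f by move=> E; subst h; apply: nfh'; apply: matched_fun ff' hh'.
have nke : k <> e by move=> E; subst k; apply: nek'; apply: matched_fun ee' kk'.
have ah'f' : aeq (aisX f') (aisX h').
  exact: aeq_trans (aeq_sym (aeqM _ _ ff')) (aeq_trans afh (aeqM _ _ hh')).
have [f1 v2f _] := aeq_valence2 (aeq_sym afh) hf nhf.
have [e1 v2e _] := aeq_valence2 (aeq_sym aek) ke nke.
have [h1 v2h _] := aeq_valence2 ah'f' fh' nfh'.
have [jf fj'] := matched_isolated (matched_sym ff') v2f.
have [je ej'] := matched_isolated (matched_sym ee') v2e.
have [fj ej] := (matched_at_sym fj', matched_at_sym ej').
have [jh hj] := matched_isolated hh' v2h.
have jef := adjacent_matched_at ej fj nef tef aef.
have jeh : je = jh.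
  apply: (adjacent_matched_at ej' (matched_at_sym hj) (nesym nhe') (esym th')).
  apply: aeq_trans (aeq_sym (aeqM _ _ ee')) (aeq_trans aef _).
  apply: aeqC; exact: aeq_trans afh (aeqM _ _ hh').
subst jf jh; apply: nfh'; apply: sub_half_anti => //.
exact/(matched_at_sub hj fj).
Qed.

End MatchTargets.

(** * Assembling the isomorphism *)

Section Uniqueness.
Context {G : groupType} {J : Type} {sigma : J -> splitting G}.
Hypothesis hiso : pairwise_nonisomorphic sigma.
Context {T1 T2 : mtree G} (N1 : nbhd sigma T1) (N2 : nbhd sigma T2).

Definition matched_dart (e : dart T1) (e' : dart T2) :=
  matched N1 N2 e e' \/ matched N1 N2 (rev e) (rev e').

Lemma col_or (T : mtree G) (N : nbhd sigma T) (e : dart T) :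
  col N (src e) \/ col N (src (rev e)).
Proof. by rewrite src_rev col_adj; case: (col N (src e)); [left|right]. Qed.

Lemma matched_dart_total e : exists e', matched_dart e e'.
Proof.
have [/(matched_total N2)[e' ee']|/(matched_total N2)[e' ee']] := col_or N1 e.
  by exists e'; left.
by exists (rev e'); right; rewrite revK.
Qed.

Lemma matched_dart_onto e' : exists e, matched_dart e e'.
Proof.
have [/(matched_total N1)[e /matched_sym ee']|] := col_or N2 e'.
  by exists e; left.
by move=> /(matched_total N1)[e /matched_sym ee']; exists (rev e); right; rewrite revK.
Qed.

Lemma matched_dart_src e e' d d' : matched_dart e e' -> matched_dart d d' ->
  src e = src d <-> src e' = src d'.
Proof.
have mixed a a' b b' : matched N1 N2 a a' -> matched N1 N2 (rev b) (rev b') ->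
    src a = src b <-> src a' = src b'.
  move=> aa' bb'.
  have := (matched_col1 aa', matched_col2 aa', (matched_col1 bb', matched_col2 bb')).
  rewrite !src_rev !col_adj => -[[ca ca'] [cb cb']].
  by split=> E; [move: cb; rewrite -E ca|move: cb'; rewrite -E ca'].
move=> [ee'|ee'] [dd'|dd'].
- by split; [apply: matched_src ee' dd'|apply: matched_src (matched_sym ee') (matched_sym dd')].
- exact: mixed.
- by have [h1 h2] := mixed _ _ _ _ dd' ee'; split=> /esym; [move=> /h1|move=> /h2] => ->.
- rewrite -(tgt_rev e) -(tgt_rev d) -(tgt_rev e') -(tgt_rev d').
  split; first exact: matched_tgt ee' dd'.
  exact: matched_tgt (matched_sym ee') (matched_sym dd').
Qed.

Lemma nbhd_unique : exists f : T1 -> T2, giso f /\ forall x, col N2 (f x) = col N1 x.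
Proof.
have [[e0 _]|/forallNP noe] := EM (exists e : dart T1, True).
  have [|||||f [fiso fE]] := @giso_of_dart_rel _ _ _ matched_dart _ _ _ _ _ e0.
  - exact: matched_dart_total.
  - exact: matched_dart_onto.
  - by move=> g e e' [] /(matched_act g); rewrite ?dact_rev; [left|right].
  - by move=> e e' []; rewrite /matched_dart !revK; [right|left].
  - exact: matched_dart_src.
  exists f; split=> // x; have [e <-] := exists_dart_src e0 x.
  have [e' ee'] := matched_dart_total e; rewrite (fE _ _ ee').
  case: ee' => ee'; first by rewrite (matched_col1 ee') (matched_col2 ee').
  have := (matched_col1 ee', matched_col2 ee'); rewrite !src_rev !col_adj.
  by move=> [/negbTE -> /negbTE ->].
(* Without darts each tree is a single vertex, which has colour [V_0] exactly when [J] is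
   inhabited. *)
have noe' (e' : dart T2) : False.
  by have [e _] := matched_dart_onto e'; apply: (noe e).
have pt1 (x y : T1) : x = y.
  by apply: contrapT => /exists_dart_away[e _ _]; apply: (noe e).
have pt2 (x y : T2) : x = y.
  by apply: contrapT => /exists_dart_away[e _ _]; apply: (noe' e).
have [[x0 _] [y0 _]] := (tree_inhabited (gtreeP T1), tree_inhabited (gtreeP T2)).
exists (fun=> y0); split.
  split=> //; first by exists (fun=> x0).
  move=> x y; rewrite (pt1 x y) !(negbTE (adj_irr (gtreeP _) _)) //.
move=> x; apply/idP/idP => /enc_cover[j [c _]].
  by rewrite (pt1 x (enc_vertex (enc N1 j) c)) vx_col.
by rewrite (pt2 y0 (enc_vertex (enc N2 j) c)) vx_col.
Qed.

End Uniqueness.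

Theorem theorem10p1 (G : groupType) (J : Type) (sigma : J -> splitting G)
    (hiso : pairwise_nonisomorphic sigma)
    (hsand : satisfies_sandwiching sigma)
    (T1 T2 : gtree G) (V0_1 : pred T1) (V0_2 : pred T2)
    (h1 : alg_reg_nbhd sigma V0_1) (h2 : alg_reg_nbhd sigma V0_2) :
  exists f : T1 -> T2, giso f /\ forall x, V0_2 (f x) = V0_1 x.
Proof.
have [N1 <-] := alg_reg_nbhd_nbhd h1 (minimal_hull (arn_minimal h1)).
have [N2 <-] := alg_reg_nbhd_nbhd h2 (minimal_hull (arn_minimal h2)).
exact: (nbhd_unique hiso N1 N2).
Qed.
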